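(* A bounded operator $T$ on $L^2$ commutes with both $S_{z,0}$ and $S_{0,\bar z}$ if and only if $T=S_{\alpha,\beta}$ for some $\alpha,\beta\in L^\infty$ where $\alpha$ is analytic and $\beta$ is co-analytic.
   Context: $S^1=\{z\in\mathbb{C}:|z|=1\}$ carries normalized Lebesgue measure; $L^2=L^2(S^1)$, $L^\infty=L^\infty(S^1)$ (complex-valued functions). $H^2$ is the Hardy space of all $f\in L^2$ whose negative Fourier coefficients vanish, and $H^{2\bot}$ is its orthogonal complement in $L^2$. $P$ and $Q=I-P$ are the orthogonal projections of $L^2$ onto $H^2$ and $H^{2\bot}$. For $\alpha,\beta\in L^\infty$, the operator $S_{\alpha,\beta}$ on $L^2$ is $S_{\alpha,\beta}f=\alpha Pf+\beta Qf$; thus $S_{z,0}f=z\,Pf$ and $S_{0,\bar z}f=\bar z\,Qf$. A function in $L^2$ is analytic if it lies in $H^2$, and co-analytic if its complex conjugate is analytic. Bounded operators are linear. *)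

(* Defs.v *)
From HB Require Import structures.
From mathcomp Require Import all_boot all_order all_algebra.
From mathcomp Require Import generic_quotient ring_quotient.
From mathcomp Require Import complex.
From mathcomp Require Import all_classical all_reals all_analysis.
From mathcomp Require Import measurable_realfun ess_sup_inf.

Set Implicit Arguments.
Unset Strict Implicit.
Unset Printing Implicit Defensive.

Import Order.TTheory GRing.Theory Num.Theory.
Import numFieldNormedType.Exports.

Local Open Scope classical_set_scope.
Local Open Scope ring_scope.

Section circle.
Context {R : realType}.

Definition circle_pred : pred R[i] := fun z => `|z| == 1.

Record circle := Circle { cval :> R[i]; cvalP : circle_pred cval }.

HB.instance Definition _ := [isSub for cval].
HB.instance Definition _ := [Choice of circle by <:].

Fact circle1_subproof : circle_pred 1.
Proof. by rewrite /circle_pred normr1. Qed.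

HB.instance Definition _ := isPointed.Build circle (Circle circle1_subproof).

Definition circle_coord (z : circle) : R * R :=
  (complex.Re (cval z), complex.Im (cval z)).

(* The trace on the circle of the Borel sets of the plane. *)
Definition circle_borel : set (set circle) :=
  preimage_set_system setT circle_coord measurable.

Fact circle_borel_sigma : sigma_algebra setT circle_borel.
Proof. by apply: sigma_algebra_preimage; exact: sigma_algebra_measurable. Qed.

Fact circle_borel0 : circle_borel set0.
Proof. by case: circle_borel_sigma. Qed.

Fact circle_borelC A : circle_borel A -> circle_borel (~` A).
Proof. by case: circle_borel_sigma => _ + _ => /[apply]; rewrite setTD. Qed.

Fact circle_borel_bigcup (F : (set circle)^nat) :
  (forall i, circle_borel (F i)) -> circle_borel (\bigcup_i (F i)).
Proof. by case: circle_borel_sigma => _ _; exact. Qed.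

HB.instance Definition _ := @isMeasurable.Build (preimage_display circle_coord)
  circle circle_borel circle_borel0 circle_borelC circle_borel_bigcup.

Fact cexp_subproof (t : R) : circle_pred (Complex (cos t) (sin t)).
Proof. by rewrite /circle_pred normc_def/= cos2Dsin2 sqrtr1. Qed.

Definition cexp (t : measurableTypeR R) : circle := Circle (cexp_subproof t).

Fact measurable_cexp : measurable_fun setT cexp.
Proof.
move=> _ _ [B mB <-]; rewrite !setTI -comp_preimage.
rewrite -[X in measurable X]setTI; apply: (_ : measurable_fun _ _) => //.
by apply: measurable_fun_pair; apply: continuous_measurable_fun => x;
  [exact: continuous_cos|exact: continuous_sin].
Qed.

HB.instance Definition _ := isMeasurableFun.Build _ _ _ _ cexp measurable_cexp.

Fact tau_gt0 : 0 < pi *+ 2 :> R.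
Proof. by rewrite pmulrn_rgt0// pi_gt0. Qed.

(* Normalized arc length: the image of the uniform probability on [0, 2 pi]
   under t |-> e^(it). *)
Definition circle_prob := distribution (uniform_prob tau_gt0) cexp.
HB.instance Definition _ := Probability.on circle_prob.
End circle.
Arguments circle : clear implicits.

Fact circle_probT {R : realType} :
  (circle_prob : {measure set (circle R) -> \bar R}) [set: _] = 1%E.
Proof. exact: probability_setT. Qed.

Section complex_measurability.
Context {R : realType}.
Implicit Types f g : circle R -> R[i].

Definition cmeasurable f : Prop :=
  measurable_fun setT (fun z => complex.Re (f z)) /\
  measurable_fun setT (fun z => complex.Im (f z)).

(* The norm `|x| of x : R[i] is itself an element of R[i]; Normc.normc x is the
   same modulus as an element of R. *)
Definition cabs f : circle R -> R := fun z => Normc.normc (f z).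

Definition cintegral f : R[i] :=
  Complex (Rintegral circle_prob setT (fun z => complex.Re (f z)))
          (Rintegral circle_prob setT (fun z => complex.Im (f z))).

Lemma cintegral_ae f g : cmeasurable f -> cmeasurable g ->
  f = g %[ae circle_prob] -> cintegral f = cintegral g.
Proof.
move=> [mf1 mf2] [mg1 mg2] fg; rewrite /cintegral /Rintegral.
congr (Complex (fine _) (fine _)); apply: ae_eq_integral => //.
- exact/measurable_EFinP.
- exact/measurable_EFinP.
- by apply: filterS fg => z + _ => /(_ Logic.I) ->.
- exact/measurable_EFinP.
- exact/measurable_EFinP.
- by apply: filterS fg => z + _ => /(_ Logic.I) ->.
Qed.

Lemma cmeasurableD f g : cmeasurable f -> cmeasurable g ->
  cmeasurable (fun z => f z + g z).
Proof.
move=> [mf1 mf2] [mg1 mg2]; split.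
  rewrite (_ : (fun _ => _) = (fun z => complex.Re (f z) + complex.Re (g z))).
    exact: measurable_funD.
  by apply/funext => z; case: (f z); case: (g z).
rewrite (_ : (fun _ => _) = (fun z => complex.Im (f z) + complex.Im (g z))).
  exact: measurable_funD.
by apply/funext => z; case: (f z); case: (g z).
Qed.

Lemma cmeasurableM f g : cmeasurable f -> cmeasurable g ->
  cmeasurable (fun z => f z * g z).
Proof.
move=> [mf1 mf2] [mg1 mg2]; split.
  rewrite (_ : (fun _ => _) = (fun z => complex.Re (f z) * complex.Re (g z)
                                - complex.Im (f z) * complex.Im (g z))).
    by apply: measurable_funB; exact: measurable_funM.
  by apply/funext => z; case: (f z); case: (g z).
rewrite (_ : (fun _ => _) = (fun z => complex.Re (f z) * complex.Im (g z)
                                + complex.Im (f z) * complex.Re (g z))).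
  by apply: measurable_funD; exact: measurable_funM.
by apply/funext => z; case: (f z); case: (g z).
Qed.

Lemma cmeasurable_cst (a : R[i]) : cmeasurable (fun=> a).
Proof. by split; exact: measurable_cst. Qed.

Lemma cmeasurable_conj f : cmeasurable f -> cmeasurable (fun z => conjc (f z)).
Proof.
move=> [mf1 mf2]; split.
  rewrite (_ : (fun _ => _) = (fun z => complex.Re (f z)))//.
  by apply/funext => z; case: (f z).
rewrite (_ : (fun _ => _) = (fun z => - complex.Im (f z))).
  exact: measurableT_comp.
by apply/funext => z; case: (f z).
Qed.

Lemma cmeasurable_cval : cmeasurable cval.
Proof.
have : measurable_fun setT (@circle_coord R) by move=> _ B mB; exists B.
by move/measurable_fun_pairP.
Qed.

Lemma measurable_cabs f : cmeasurable f -> measurable_fun setT (cabs f).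
Proof.
move=> [mf1 mf2].
rewrite (_ : cabs f =
  fun z => Num.sqrt (complex.Re (f z) ^+ 2 + complex.Im (f z) ^+ 2)).
  apply: (@measurableT_comp _ _ _ _ _ _ (@Num.sqrt R)).
    by apply: continuous_measurable_fun; exact: sqrt_continuous.
  by apply: measurable_funD; exact: measurable_funX.
by apply/funext => z; rewrite /cabs; case: (f z).
Qed.

Lemma cmeasurable_exp (n : int) :
  cmeasurable (fun z : circle R => cval z ^ n).
Proof.
have mX (k : nat) : cmeasurable (fun z : circle R => cval z ^+ k).
  elim: k => [|k ih]; first exact: cmeasurable_cst.
  rewrite (_ : (fun _ => _) = (fun z : circle R => cval z * cval z ^+ k)).
    exact: cmeasurableM cmeasurable_cval ih.
  by apply/funext => z; rewrite exprS.
case: n => n; first exact: mX.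
rewrite (_ : (fun _ => _) = (fun z : circle R => conjc (cval z ^+ n.+1))).
  exact/cmeasurable_conj/mX.
apply/funext => z; rewrite NegzE -exprnN rmorphXn/= -exprVn; congr (_ ^+ _).
have := cvalP z; rewrite /circle_pred => /eqP z1.
have z0 : cval z != 0 by rewrite -normr_eq0 z1 oner_eq0.
apply: (mulfI z0); rewrite mulfV// -[RHS]/(cval z * (conjc (cval z))).
have := add_Re2_Im2 (cval z); rewrite z1 expr1n => <-.
by case: (cval z) => a b; apply/eqP; rewrite eq_complex/= !mulrN opprK (mulrC b a) addNr -!expr2 !eqxx.
Qed.

Lemma normc_ge0 (x : R[i]) : 0 <= Normc.normc x.
Proof. by case: x => a b; exact: sqrtr_ge0. Qed.

Lemma cabs_ge0 f z : 0 <= cabs f z.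
Proof. exact: normc_ge0. Qed.

End complex_measurability.

Lemma finite_norm_le d (T : measurableType d) (R : realType)
    (mu : {measure set T -> \bar R}) (p : \bar R) (f g : T -> R) :
  (1 <= p)%E -> measurable_fun setT f -> measurable_fun setT g ->
  (\forall x \ae mu, `|f x| <= `|g x|) ->
  finite_norm mu p g -> finite_norm mu p f.
Proof.
move=> p1 mf mg fg; rewrite /finite_norm; apply: le_lt_trans.
rewrite unlock /Lnorm; case: p p1 => [r||//].
  rewrite lee_fin => r1; have r0 : 0 < r by rewrite (lt_le_trans ltr01).
  have mabs (h : T -> R) : measurable_fun setT h ->
      measurable_fun setT (fun x => `|(EFin \o h) x| `^ r)%E.
    move=> mh; apply: (measurableT_comp (measurable_poweR r)).
    exact/measurableT_comp/measurable_EFinP.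
  have pos (x : \bar R) : (0 <= x)%E -> x \in `[0%E, +oo%E].
    by move=> x0; rewrite in_itv/= x0 leey.
  apply: gt0_ler_poweR; first by rewrite invr_ge0 ltW.
  - by apply/pos/integral_ge0 => x _; exact: poweR_ge0.
  - by apply/pos/integral_ge0 => x _; exact: poweR_ge0.
  apply: ae_ge0_le_integral => //.
  - by move=> x _; exact: poweR_ge0.
  - exact: mabs.
  - by move=> x _; exact: poweR_ge0.
  - exact: mabs.
  - apply: filterS fg => x fgx _ /=.
    by rewrite lee_fin ge0_ler_powR ?nnegrE// ltW.
move=> _; case: ifPn => // _; apply: le_ess_sup.
by apply: filterS fg => x; rewrite /= lee_fin.
Qed.

Section Lp_functions.
Context {R : realType} (p : \bar R) (p1 : (1 <= p)%E).
Implicit Types f g : circle R -> R[i].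

Definition in_Lp f : Prop :=
  cmeasurable f /\ finite_norm circle_prob p (cabs f).

(* The proof of 1 <= p is a phantom argument: it is what makes the set closed
   under addition, and the algebraic instances are keyed on it. *)
Definition Lp_pred_of & (1 <= p)%E : {pred circle R -> R[i]} := [pred f | `[< in_Lp f >]].
Local Notation Lp_pred := (Lp_pred_of p1).

Lemma Lp_predP f : reflect (in_Lp f) (f \in Lp_pred).
Proof. by rewrite inE; exact: asboolP. Qed.

Lemma cabs_Lfun f : in_Lp f -> cabs f \in Lfun circle_prob p.
Proof.
by move=> [mf nf]; apply/andP; split; rewrite inE//=; exact: measurable_cabs.
Qed.

Fact Lp_submod_closed : submod_closed Lp_pred.
Proof.
split.
  apply/Lp_predP; split; first exact: cmeasurable_cst.
  rewrite (_ : cabs _ = cst 0); first exact: finite_norm_cst0.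
  by apply/funext => z; rewrite /cabs Normc.normc0.
move=> a f g /Lp_predP Lf /Lp_predP Lg; apply/Lp_predP.
have mfg : cmeasurable (a *: f + g).
  apply: (cmeasurableD (cmeasurableM (cmeasurable_cst a) Lf.1) Lg.1).
split=> //.
have : Normc.normc a *: cabs f + cabs g \in Lfun circle_prob p.
  by rewrite rpredD ?rpredZ ?cabs_Lfun.
move=> /andP[/[!inE] mh nh].
apply: finite_norm_le nh => //; first exact: measurable_cabs.
apply/nearW => z.
rewrite !ger0_norm ?addr_ge0 ?mulr_ge0 ?cabs_ge0 ?normc_ge0//.
rewrite /cabs (le_trans (le_normcD _ _))// lerD2r.
by rewrite Normc.normcM.
Qed.

HB.instance Definition _ :=
  GRing.isSubmodClosed.Build R[i] (circle R -> R[i]) Lp_pred Lp_submod_closed.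

Record LpFun := MkLpFun { lpfun :> circle R -> R[i]; lpfunP : lpfun \in Lp_pred }.

HB.instance Definition _ := [isSub for lpfun].
HB.instance Definition _ := [Choice of LpFun by <:].
HB.instance Definition _ := [SubChoice_isSubLmodule of LpFun by <:].

Definition Lp_null : {pred LpFun} :=
  [pred f : LpFun | `[< (f : circle R -> R[i]) = cst 0 %[ae circle_prob] >]].

Lemma Lp_nullP (f : LpFun) :
  reflect ((f : circle R -> R[i]) = cst 0 %[ae circle_prob]) (f \in Lp_null).
Proof. exact: asboolP. Qed.

Fact Lp_null_zmod_closed : zmod_closed Lp_null.
Proof.
split; first by apply/Lp_nullP; exact: aeW.
move=> f g /Lp_nullP f0 /Lp_nullP g0; apply/Lp_nullP.
apply: filterS2 f0 g0 => z f0 g0 _ /=; rewrite -[LHS]/(f z - g z).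
by rewrite f0// g0// subrr.
Qed.

HB.instance Definition _ :=
  GRing.isZmodClosed.Build LpFun Lp_null Lp_null_zmod_closed.

Definition Lp : Type := Quotient.quot Lp_null.
HB.instance Definition _ := GRing.Zmodule.on Lp.
HB.instance Definition _ := ZmodQuotient.on Lp.

Lemma Lp_eqP (f g : LpFun) :
  reflect ((f : circle R -> R[i]) = g %[ae circle_prob])
          (\pi_Lp f == \pi_Lp g)%qT.
Proof.
apply: (iffP idP).
  rewrite -Quotient.idealrBE => /Lp_nullP.
  apply: filterS => z + _ => /(_ Logic.I).
  by rewrite -[X in X = _ -> _]/(f z - g z) => /eqP; rewrite subr_eq0 => /eqP.
move=> fg; rewrite -Quotient.idealrBE; apply/Lp_nullP.
apply: filterS fg => z + _ => /(_ Logic.I) fg.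
by rewrite -[LHS]/(f z - g z) fg subrr.
Qed.

Lemma reprLp_ae (f : LpFun) :
  (repr (\pi_Lp f)%qT : circle R -> R[i]) = f %[ae circle_prob].
Proof. by apply/Lp_eqP; rewrite reprK. Qed.

Definition Lp_scale (a : R[i]) (f : Lp) : Lp := (\pi_Lp (a *: repr f))%qT.

Lemma pi_Lp_scale a (f : LpFun) :
  Lp_scale a (\pi_Lp f)%qT = (\pi_Lp (a *: f))%qT.
Proof.
apply/eqP/Lp_eqP; have := reprLp_ae f.
apply: filterS => z + _ => /(_ Logic.I) fz.
exact: (congr1 (fun y => a *: y) fz).
Qed.

Fact Lp_scaleA a b (f : Lp) : Lp_scale a (Lp_scale b f) = Lp_scale (a * b) f.
Proof.
by rewrite -[f]reprK (pi_Lp_scale b) (pi_Lp_scale a) (pi_Lp_scale (a * b)) scalerA.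
Qed.

Fact Lp_scale1 : left_id 1 Lp_scale.
Proof. by move=> f; rewrite -[f]reprK pi_Lp_scale scale1r. Qed.

Fact Lp_scaleDr : right_distributive Lp_scale +%R.
Proof.
move=> a f g; rewrite -[f]reprK -[g]reprK -raddfD/=.
by rewrite !(pi_Lp_scale a) scalerDr raddfD.
Qed.

Fact Lp_scaleDl (f : Lp) : {morph Lp_scale^~ f : a b / a + b}.
Proof.
move=> a b; rewrite -[f]reprK (pi_Lp_scale a) (pi_Lp_scale b).
by rewrite (pi_Lp_scale (a + b)) scalerDl raddfD.
Qed.

HB.instance Definition _ := GRing.Zmodule_isLmodule.Build R[i] Lp
  Lp_scaleA Lp_scale1 Lp_scaleDr Lp_scaleDl.

End Lp_functions.

Section L2_Linf.
Context {R : realType}.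

Fact le1_2 : (1 <= 2%:E :> \bar R)%E.
Proof. by rewrite lee_fin ler1n. Qed.

Fact le1_oo : (1 <= +oo :> \bar R)%E.
Proof. exact: leey. Qed.

Definition L2 : Type := Lp le1_2.
Definition Linf : Type := Lp le1_oo.
HB.instance Definition _ := GRing.Lmodule.on L2.
HB.instance Definition _ := GRing.Lmodule.on Linf.

Section conjugation.
Context (p : \bar R) (p1 : (1 <= p)%E).

Fact Lp_conj_subproof (f : LpFun p1) :
  (fun z => conjc (f z)) \in Lp_pred_of p1.
Proof.
have /Lp_predP[mf nf] := lpfunP f; apply/Lp_predP; split.
  exact: cmeasurable_conj.
rewrite (_ : cabs _ = cabs f)//; apply/funext => z.
by rewrite /cabs; case: (f z) => a b /=; rewrite sqrrN.
Qed.

Definition LpFun_conj (f : LpFun p1) : LpFun p1 :=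
  MkLpFun (Lp_conj_subproof f).

Definition Lp_conj (f : Lp p1) : Lp p1 := (\pi_(Lp p1) (LpFun_conj (repr f)))%qT.

Lemma pi_Lp_conj (f : LpFun p1) :
  Lp_conj (\pi_(Lp p1) f)%qT = (\pi_(Lp p1) (LpFun_conj f))%qT.
Proof.
apply/eqP/Lp_eqP; apply: filterS (reprLp_ae f) => z + _ => /(_ Logic.I) fz.
exact: (congr1 conjc fz).
Qed.

End conjugation.

Fact Linf_L2_subproof (a : LpFun le1_oo) :
  (a : circle R -> R[i]) \in Lp_pred_of le1_2.
Proof.
have /Lp_predP La := lpfunP a; apply/Lp_predP; split; first exact: La.1.
have /(Lfun_subset le1_2 le1_oo) : cabs a \in Lfun circle_prob +oo.
  exact: cabs_Lfun.
move=> /(_ (fin_num_measure _ _ measurableT) (leey _)).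
by move=> /andP[_]; rewrite inE.
Qed.

Definition LinfFun_L2 (a : LpFun le1_oo) : LpFun le1_2 :=
  MkLpFun (Linf_L2_subproof a).

Definition Linf_L2 (a : Linf) : L2 := (\pi_L2 (LinfFun_L2 (repr a)))%qT.

Lemma pi_Linf_L2 (a : LpFun le1_oo) :
  Linf_L2 (\pi_Linf a)%qT = (\pi_L2 (LinfFun_L2 a))%qT.
Proof. by apply/eqP/Lp_eqP; exact: reprLp_ae. Qed.

Fact Linf_mul_subproof (a : LpFun le1_oo) (f : LpFun le1_2) :
  (fun z => a z * f z) \in Lp_pred_of le1_2.
Proof.
have /Lp_predP[ma na] := lpfunP a; have /Lp_predP[mf nf] := lpfunP f.
have maf := cmeasurableM ma mf; apply/Lp_predP; split=> //.
have [M aM] : exists M, \forall z \ae circle_prob, `|cabs a z| <= M.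
  apply: ess_supr_bounded; move: na; rewrite /finite_norm unlock /Lnorm.
  by rewrite circle_probT lte01.
have : M *: cabs f \in Lfun circle_prob 2%:E.
  have /= Zc := GRing.subsemimod_closedZ (GRing.submod_closed_semi
    (Lfun_submod_closed circle_prob le1_2)).
  by apply: Zc; apply: (cabs_Lfun (conj mf nf)).
move=> /andP[/[!inE] mh nh].
apply: finite_norm_le nh => //; [exact: le1_2|exact: measurable_cabs|].
apply: filterS aM => z /=; rewrite ger0_norm ?cabs_ge0// => az.
rewrite ger0_norm ?cabs_ge0// ger0_norm; last first.
  by rewrite mulr_ge0 ?cabs_ge0// (le_trans _ az)// cabs_ge0.
by rewrite /cabs Normc.normcM ler_wpM2r// normc_ge0.
Qed.

Definition LinfFun_mul (a : LpFun le1_oo) (f : LpFun le1_2) : LpFun le1_2 :=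
  MkLpFun (Linf_mul_subproof a f).

Definition Linf_mul (a : Linf) (f : L2) : L2 :=
  (\pi_L2 (LinfFun_mul (repr a) (repr f)))%qT.

Lemma pi_Linf_mul (a : LpFun le1_oo) (f : LpFun le1_2) :
  Linf_mul (\pi_Linf a)%qT (\pi_L2 f)%qT = (\pi_L2 (LinfFun_mul a f))%qT.
Proof.
apply/eqP/Lp_eqP; apply: filterS2 (reprLp_ae a) (reprLp_ae f).
by move=> z + + _ => /(_ Logic.I) az /(_ Logic.I) fz; exact: (congr2 *%R az fz).
Qed.

Fact z_subproof : (@cval R) \in Lp_pred_of le1_oo.
Proof.
apply/Lp_predP; split; first exact: cmeasurable_cval.
rewrite (_ : cabs _ = cst 1); last first.
  apply/funext => z; have /eqP := cvalP z; rewrite /cabs.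
  by case: (cval z) => a b /(congr1 (@complex.Re R)).
rewrite /finite_norm unlock /Lnorm.
rewrite circle_probT lte01 (_ : _ \o _ = cst 1%E); last first.
  by apply/funext => z /=; rewrite normr1.
by rewrite ess_sup_cst ?circle_probT ?lte01 ?ltry.
Qed.

Definition z_Linf : Linf := (\pi_Linf (MkLpFun z_subproof))%qT.

Definition zbar_Linf : Linf := Lp_conj z_Linf.

Implicit Types f g : L2.

(* On classes, the integrals are computed on the representative chosen by repr;
   the pi_ lemmas below show that the choice does not matter. *)
Definition inner f g : R[i] := cintegral (fun z => repr f z * conjc (repr g z)).

Definition L2norm f : R := fine ('N[circle_prob]_2 [EFin \o cabs (repr f)])%E.

Definition fourier f (n : int) : R[i] :=
  cintegral (fun z => repr f z * conjc (cval z ^ n)).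

Lemma pi_inner (f g : LpFun le1_2) :
  inner (\pi_L2 f)%qT (\pi_L2 g)%qT = cintegral (fun z => f z * conjc (g z)).
Proof.
have mL (h : LpFun le1_2) : cmeasurable h by have /Lp_predP[] := lpfunP h.
apply: cintegral_ae; rewrite /inner.
- exact: cmeasurableM (mL _) (cmeasurable_conj (mL _)).
- exact: cmeasurableM (mL _) (cmeasurable_conj (mL _)).
- apply: filterS2 (reprLp_ae f) (reprLp_ae g) => z + + _.
  by move=> /(_ Logic.I) fz /(_ Logic.I) gz; rewrite fz gz.
Qed.

Lemma pi_fourier (f : LpFun le1_2) n :
  fourier (\pi_L2 f)%qT n = cintegral (fun z => f z * conjc (cval z ^ n)).
Proof.
have mL (h : LpFun le1_2) : cmeasurable h by have /Lp_predP[] := lpfunP h.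
apply: cintegral_ae.
- exact: cmeasurableM (mL _) (cmeasurable_conj (cmeasurable_exp _)).
- exact: cmeasurableM (mL _) (cmeasurable_conj (cmeasurable_exp _)).
- by apply: filterS (reprLp_ae f) => z + _ => /(_ Logic.I) ->.
Qed.

Lemma pi_L2norm (f : LpFun le1_2) :
  L2norm (\pi_L2 f)%qT = fine ('N[circle_prob]_2 [EFin \o cabs f])%E.
Proof.
have mL (h : LpFun le1_2) :
    measurable_fun setT (fun z => `|(EFin \o cabs h) z| `^ 2)%E.
  apply: (measurableT_comp (measurable_poweR 2)).
  apply/measurableT_comp/measurable_EFinP => //; apply: measurable_cabs.
  by have /Lp_predP[] := lpfunP h.
rewrite /L2norm unlock /Lnorm; congr (fine (_ `^ _)%E).
apply: ae_eq_integral => //.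
by apply: filterS (reprLp_ae f) => z + _ => /(_ Logic.I) fz; rewrite /= /cabs fz.
Qed.

Definition hardy : set L2 := [set f | forall n : int, n < 0 -> fourier f n = 0].

Definition ortho (M : set L2) : set L2 :=
  [set f | forall g, M g -> inner f g = 0].

(* For M a closed subspace, such as hardy, there is exactly one g in M with f - g
   orthogonal to M, so that the default value 0 of xget is never used. *)
Definition orthoproj (M : set L2) (f : L2) : L2 :=
  xget 0 [set g | M g /\ ortho M (f - g)].

Definition proj_hardy : L2 -> L2 := orthoproj hardy.
Definition proj_hardyC : L2 -> L2 := fun f => f - proj_hardy f.

Definition S_op (a b : Linf) : L2 -> L2 :=
  fun f => Linf_mul a (proj_hardy f) + Linf_mul b (proj_hardyC f).

Definition bounded_operator (T : L2 -> L2) : Prop :=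
  linear T /\ exists M : R, forall f, L2norm (T f) <= M * L2norm f.

Definition analytic (f : L2) : Prop := hardy f.
Definition coanalytic (f : L2) : Prop := analytic (Lp_conj f).

End L2_Linf.
Arguments L2 : clear implicits.
Arguments Linf : clear implicits.

(* Main.v *)
(* Testing commutation on [H^2] and on its complement shows that [T] preserves
   both, commutes with [z] on the first and with [conj z] on the second; the
   antiunitary map [f |-> conj (z f)] exchanges the two situations, so only
   [H^2] matters.  There [T p = p * T 1] for every polynomial [p], whence
   [|p * T 1| <= M |p|].  Since the squares of real trigonometric polynomials
   are the [|p|^2] on the circle, and since bounded pointwise limits of real
   trigonometric polynomials reach the indicator of every Borel set, this forces
   [|T 1| <= M] almost everywhere.  The same limits give uniqueness of Fourier
   coefficients; completeness of [L^2] and Bessel's inequality then give the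
   projection onto [H^2] and the density of polynomials in it. *)
Require Import Defs.
From mathcomp Require Import all_boot all_order all_algebra.
From mathcomp Require Import generic_quotient ring_quotient.
From mathcomp Require Import complex ring lra.
From mathcomp Require Import all_classical all_reals all_analysis.
From mathcomp Require Import measurable_realfun ess_sup_inf.

Set Implicit Arguments.
Unset Strict Implicit.
Unset Printing Implicit Defensive.

Import Order.TTheory GRing.Theory Num.Theory.
Import numFieldNormedType.Exports.

Local Open Scope classical_set_scope.
Local Open Scope ring_scope.

(** * Bounded pointwise limits *)

(** The commutation controls [T 1] only through integrals of [|T 1|^2] against squares [|p|^2], and
    these squares do not form a vector space. The remedy is to pass to the limit in [h] and not in
    [h^2]: by dominated convergence the inequality [0 <= int g h^2] survives bounded pointwise
    limits of [h], and an indicator is its own square. It is therefore enough that indicators lie in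
    the bounded pointwise closure of an algebra of functions; they are polynomials in a sign
    function, and signs are limits of an iterated cubic polynomial. Applied to a function and to its
    opposite, the same positivity test becomes a uniqueness theorem. Density is then used without
    convergent sequences in [L^2]: a fixed scalar that can be written as an inner product with
    arbitrarily small vectors is zero. *)

Section sign_iteration.
Context {R : realType}.
Implicit Types x : R.

(** The Newton-Schulz step for the sign: an odd polynomial with fixed points -1, 0 and 1. Being a
    polynomial, it can be iterated inside any algebra of functions. *)
Definition cubic x : R := 2^-1 * (3 * x - x * (x * x)).

Lemma cubic_itv x : 0 <= x <= 1 -> x <= cubic x <= 1.
Proof.
move=> /andP[x0 x1]; have x2 : 0 <= 1 - x ^+ 2 by rewrite subr_ge0 expr_le1.
apply/andP; split; rewrite -subr_ge0.
  have -> : cubic x - x = 2^-1 * (x * (1 - x ^+ 2)) by rewrite /cubic; field.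
  exact: mulr_ge0 (mulr_ge0 _ _).
have -> : 1 - cubic x = 2^-1 * ((1 - x) ^+ 2 * (2 + x)) by rewrite /cubic; field.
by apply: mulr_ge0 => //; apply: mulr_ge0; [exact: sqr_ge0|exact: addr_ge0].
Qed.

Lemma cubicN x : cubic (- x) = - cubic x.
Proof. by rewrite /cubic; ring. Qed.

Lemma cubic_norm x : `|x| <= 1 -> `|cubic x| <= 1.
Proof.
wlog x0 : x / 0 <= x => [hw|].
  have [/hw//|/ltW x0 x1] := leP 0 x.
  by rewrite -normrN -cubicN hw ?oppr_ge0// normrN.
rewrite (ger0_norm x0) => x1; have /cubic_itv/andP[xx cx1] : 0 <= x <= 1.
  by rewrite x0.
by rewrite ger0_norm// (le_trans x0).
Qed.

Lemma cubic_iter_itv x n : 0 < x <= 1 ->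
  x <= iter n cubic x <= 1 /\ iter n cubic x <= iter n.+1 cubic x.
Proof.
move=> /andP[x0 x1]; elim: n => [|n [/andP[xn n1] _]].
  by rewrite /= lexx x1; have /cubic_itv/andP[] : 0 <= x <= 1 by rewrite ltW.
have /cubic_itv/andP[yn y1] : 0 <= iter n cubic x <= 1.
  by rewrite n1 (le_trans (ltW x0)).
rewrite -iterS in yn y1.
have xy := le_trans xn yn.
split; first by rewrite xy.
by have /cubic_itv/andP[] : 0 <= iter n.+1 cubic x <= 1 by rewrite y1 (le_trans (ltW x0)).
Qed.

(** The iterates increase and stay below 1, so they converge to a fixed point; it is at least
    [x > 0], which leaves only 1. *)
Lemma cubic_iter_gt0 x : 0 < x <= 1 -> iter n cubic x @[n --> \oo] --> (1 : R).
Proof.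
move=> x01; have /andP[x0 x1] := x01; set u := fun n => iter n cubic x.
have nd : nondecreasing_seq u.
  by apply/nondecreasing_seqP => n; have [] := cubic_iter_itv n x01.
have ub : has_ubound (range u).
  by exists 1 => _ [n _ <-]; have [/andP[]] := cubic_iter_itv n x01.
have := nondecreasing_cvgn nd ub; set l := sup _ => ul.
have xl : x <= l by apply: sup_ubound => //; exists 0%N.
have su : cubic (u n) @[n --> \oo] --> cubic l.
  apply: cvgMl_tmp; apply: cvgB; first exact: cvgMl_tmp.
  by apply: cvgM => //; exact: cvgM.
have su' : cubic (u n) @[n --> \oo] --> l.
  have -> : (fun n => cubic (u n)) = (fun n => u n.+1) by [].
  by rewrite (cvg_shiftS u).
have : cubic l = l by exact: (cvg_unique (@norm_hausdorff _ _) su su').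
rewrite /cubic => e.
have l0 : 0 < l by exact: lt_le_trans xl.
have : l * ((1 - l) * (1 + l)) = 0 by nra.
move/eqP; rewrite !mulf_eq0 (gt_eqF l0)/= [1 + l == 0]gt_eqF ?addr_gt0// orbF.
by rewrite subr_eq0 => /eqP l1; rewrite [X in _ --> X]l1.
Qed.

Lemma cubic_iter_cvg x : `|x| <= 1 -> iter n cubic x @[n --> \oo] --> Num.sg x.
Proof.
have cubicNn y n : iter n cubic (- y) = - iter n cubic y.
  by elim: n => //= n ->; rewrite cubicN.
have cubic0 n : iter n cubic 0 = 0.
  by elim: n => //= n ->; rewrite /cubic; ring.
rewrite ler_norml => /andP[xN1 x1]; have [x0|x0|x0] := sgrP x.
- rewrite (_ : (fun _ => _) = cst 0); first exact: cvg_cst.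
  by apply/funext => n; rewrite x0 cubic0.
- by apply: cubic_iter_gt0; rewrite x0.
- rewrite (_ : (fun _ => _) = (fun n => - iter n cubic (- x))).
    by apply: cvgN; apply: cubic_iter_gt0; rewrite oppr_gt0 x0 lerNl.
  by apply/funext => n; rewrite cubicNn opprK.
Qed.

End sign_iteration.

Section bounded_pointwise_closure.
Context {R : realType} {T : Type} (A : set (T -> R)).

(** Limits of limits are allowed, because a single passage to the limit from trigonometric
    polynomials does not reach every Borel indicator. The bound [M] is uniform in [n] and [x], as
    dominated convergence on a finite measure requires. *)
Inductive bpclosure : (T -> R) -> Prop :=
| bpclosure_sub h : A h -> bpclosure h
| bpclosure_lim (h_ : nat -> T -> R) h M :
    (forall n, bpclosure (h_ n)) -> (forall n x, `|h_ n x| <= M) ->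
    (forall x, h_ n x @[n --> \oo] --> h x) -> bpclosure h.

Hypothesis A_bounded : forall h, A h -> exists M, forall x, `|h x| <= M.
Hypothesis A_cst : forall c, A (fun=> c).
Hypothesis AD : forall h k, A h -> A k -> A (fun x => h x + k x).
Hypothesis AM : forall h k, A h -> A k -> A (fun x => h x * k x).

Lemma bpclosure_bounded h : bpclosure h -> exists M, forall x, `|h x| <= M.
Proof.
case=> [{}h /A_bounded//|h_ {}h M _ hM hh]; exists M => x.
by apply: (cvgr_to_le (cvg_norm (hh x))); exact: nearW.
Qed.

Lemma bpclosureD h k :
  bpclosure h -> bpclosure k -> bpclosure (fun x => h x + k x).
Proof.
(* Induction on [k] with [h] fixed; only the base case, where [k] lies in [A], calls for an
   induction on [h]. *)
move=> hA; elim=> [{}k kA|k_ {}k M kA kD kM kk].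
  elim: hA => [{}h hA|h_ {}h M hA hD hM hh].
    exact/bpclosure_sub/AD.
  have [N kN] := A_bounded kA.
  apply: (@bpclosure_lim (fun n x => h_ n x + k x) _ (M + N)) => // [n x|x].
    by rewrite (le_trans (ler_normD _ _))// lerD.
  by apply: cvgD => //; exact: cvg_cst.
have [N hN] := bpclosure_bounded hA.
apply: (@bpclosure_lim (fun n x => h x + k_ n x) _ (N + M)) => // [n x|x].
  by rewrite (le_trans (ler_normD _ _))// lerD.
by apply: cvgD => //; exact: cvg_cst.
Qed.

Lemma bpclosureM h k :
  bpclosure h -> bpclosure k -> bpclosure (fun x => h x * k x).
Proof.
move=> hA; elim=> [{}k kA|k_ {}k M kA kD kM kk].
  elim: hA => [{}h hA|h_ {}h M hA hD hM hh].
    exact/bpclosure_sub/AM.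
  have [N kN] := A_bounded kA.
  apply: (@bpclosure_lim (fun n x => h_ n x * k x) _ (M * N)) => // [n x|x].
    by rewrite normrM ler_pM.
  by apply: cvgM => //; exact: cvg_cst.
have [N hN] := bpclosure_bounded hA.
apply: (@bpclosure_lim (fun n x => h x * k_ n x) _ (N * M)) => // [n x|x].
  by rewrite normrM ler_pM.
by apply: cvgM => //; exact: cvg_cst.
Qed.

Lemma bpclosure_cst c : bpclosure (fun=> c).
Proof. exact: bpclosure_sub. Qed.

Lemma bpclosure_sg h : bpclosure h -> bpclosure (fun x => Num.sg (h x)).
Proof.
move=> hA; have [M hM] := bpclosure_bounded hA.
(* The iteration is controlled on [-1, 1]; scaling by [c > 0] brings [h] there and leaves its sign
   unchanged. *)
pose c := (`|M| + 1)^-1; have c0 : 0 < c by rewrite invr_gt0 ltr_wpDl.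
have ch1 x : `|c * h x| <= 1.
  rewrite normrM gtr0_norm// mulrC ler_pdivrMr ?ltr_wpDl// mul1r.
  by rewrite (le_trans (hM x))// (le_trans (ler_norm _))// lerDl.
rewrite (_ : (fun _ => _) = (fun x => Num.sg (c * h x))); last first.
  by apply/funext => x; rewrite sgrM (gtr0_sg c0) mul1r.
apply: (@bpclosure_lim (fun n x => iter n cubic (c * h x)) _ 1) => [n|n x|x].
- elim: n => [|n ih]; first by apply: bpclosureM hA; exact: bpclosure_cst.
  rewrite (_ : (fun _ => _) = (fun x => 2^-1 * (3 * iter n cubic (c * h x) +
    (-1) * (iter n cubic (c * h x) *
            (iter n cubic (c * h x) * iter n cubic (c * h x)))))).
    apply: bpclosureM; [exact: bpclosure_cst|apply: bpclosureD].
      by apply: bpclosureM ih; exact: bpclosure_cst.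
    apply: bpclosureM; first exact: bpclosure_cst.
    by do 2 apply: bpclosureM => //.
  by apply/funext => x /=; rewrite /cubic; ring.
- elim: n => [|n]; first exact: ch1.
  by rewrite iterS; exact: cubic_norm.
- exact: cubic_iter_cvg.
Qed.

Lemma bpclosure_pos h : bpclosure h -> bpclosure \1_[set x | 0 < h x].
Proof.
move=> /bpclosure_sg hA.
rewrite (_ : \1__ = (fun x => 2^-1 * (Num.sg (h x) + Num.sg (h x) * Num.sg (h x)))).
  apply: bpclosureM; [exact: bpclosure_cst|apply: bpclosureD => //].
  exact: bpclosureM.
apply/funext => x; rewrite indicE; case: sgrP => [h0|h0|h0].
- by rewrite memNset/= ?h0 ?ltxx//; lra.
- by rewrite mem_set//=; lra.
- by rewrite memNset/= ?mulrNN ?mulr1 ?addNr ?mulr0//; apply/negP; rewrite -leNgt ltW.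
Qed.

(** Products give intersections and affine combinations give complements; a countable union is the
    limit of its finite unions, whose indicators are eventually constant at each point. *)
Lemma sigma_algebra_bpclosure : sigma_algebra setT [set E | bpclosure \1_E].
Proof.
have clC E : bpclosure \1_E -> bpclosure \1_(~` E).
  move=> cE; rewrite (_ : \1__ = (fun x => 1 + (-1) * \1_E x)).
    apply: bpclosureD; first exact: bpclosure_cst.
    by apply: bpclosureM cE; exact: bpclosure_cst.
  by apply/funext => x; rewrite !indicE in_setC; case: (x \in E) => /=; lra.
have clI E F : bpclosure \1_E -> bpclosure \1_F -> bpclosure \1_(E `&` F).
  by move=> cE cF; rewrite indicI; exact: bpclosureM.
split => /= [|E|F cF].
- by rewrite indic0; exact: bpclosure_cst.
- by rewrite setTD; exact: clC.
have cU n : bpclosure \1_(\bigcup_(i < n) F i).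
  elim: n => [|n ih]; first by rewrite bigcup_mkord big_ord0 indic0; exact: bpclosure_cst.
  rewrite bigcup_mkord big_ord_recr/= -bigcup_mkord -[_ `|` _]setCK setCU.
  exact: clC (clI _ _ (clC _ ih) (clC _ (cF n))).
apply: (@bpclosure_lim (fun n => \1_(\bigcup_(i < n) F i)) _ 1 cU) => [n x|x].
  by rewrite indicE; case: (_ \in _); rewrite ?normr1 ?normr0.
apply: cvg_near_cst; case: (pselect ((\bigcup_i F i) x)) => [[N _ FN]|nF].
  exists N.+1 => // n /= Nn; rewrite !indicE !mem_set//; first by exists N.
  by exists N.
exists 0%N => // n _; rewrite !indicE !memNset// => -[i ? ?].
by apply: nF; exists i.
Qed.

End bounded_pointwise_closure.

(** * Positivity tested on squares *)

Section square_test.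
Context d (T : measurableType d) (R : realType).
Variable mu : {measure set T -> \bar R}.

Lemma integrableM_bounded (g h : T -> R) M :
  mu.-integrable setT (EFin \o g) -> measurable_fun setT h ->
  (forall x, `|h x| <= M) ->
  mu.-integrable setT (EFin \o (fun x => g x * h x)).
Proof.
move=> ig mh hM; apply: (integrableMl _ ig) => //.
exists M; split; first exact: num_real.
by move=> N MN x _; exact: le_trans (hM x) (ltW MN).
Qed.

Variables (A : set (T -> R)) (g : T -> R).
Hypothesis A_bounded : forall h, A h -> exists M, forall x, `|h x| <= M.
Hypothesis A_cst : forall c, A (fun=> c).
Hypothesis AD : forall h k, A h -> A k -> A (fun x => h x + k x).
Hypothesis AM : forall h k, A h -> A k -> A (fun x => h x * k x).
Hypothesis mA : forall h, A h -> measurable_fun setT h.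
Hypothesis A_gen : @measurable _ T `<=` <<s [set [set x | 0 < h x] | h in A] >>.

Lemma measurable_bpclosure h : bpclosure A h -> measurable_fun setT h.
Proof.
elim=> [{}h /mA//|h_ {}h M _ mh _ hh].
by apply: (measurable_fun_cvg mh) => x _; exact: hh.
Qed.

Lemma bpclosure_indic E : measurable E -> bpclosure A \1_E.
Proof.
move=> /A_gen; move: E; apply: smallest_sub.
  exact: (sigma_algebra_bpclosure A_bounded A_cst AD AM).
move=> _ [h hA <-]; apply: (bpclosure_pos A_bounded A_cst AD AM).
exact: bpclosure_sub.
Qed.

(* Passing to bounded pointwise limits, the hypothesis on squares reaches the
   indicator of [g < 0]. *)
Lemma ae_ge0_square_test : mu.-integrable setT (EFin \o g) ->
  (forall h, A h -> 0 <= \int[mu]_x (g x * h x ^+ 2)) ->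
  \forall x \ae mu, 0 <= g x.
Proof.
move=> ig g0.
have clg h : bpclosure A h -> 0 <= \int[mu]_x (g x * h x ^+ 2).
  elim=> [{}h /g0//|h_ {}h M hA h0 hM hh].
  have mh_ n : measurable_fun setT (h_ n) by exact: measurable_bpclosure.
  have mh : measurable_fun setT h.
    by apply: (measurable_fun_cvg mh_) => x _; exact: hh.
  have mg : measurable_fun setT g by apply/measurable_EFinP/(measurable_int mu).
  have igM : mu.-integrable setT (fun x => (`|g x| * M ^+ 2)%:E).
    apply: (@integrableM_bounded _ (fun=> M ^+ 2) (`|M ^+ 2|)) => //.
    by have := integrable_norm ig.
  have [] := @dominated_convergence _ _ _ mu setT measurableT
    (fun n x => (g x * h_ n x ^+ 2)%:E) (fun x => (g x * h x ^+ 2)%:E)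
    (fun x => (`|g x| * M ^+ 2)%:E).
  - move=> n; apply/measurable_EFinP; apply: measurable_funM => //.
    exact: measurable_funX.
  - apply/measurable_EFinP; apply: measurable_funM => //.
    exact: measurable_funX.
  - apply: aeW => x _; apply: cvg_EFin; first exact: nearW.
    apply: cvgMl_tmp.
    by rewrite expr2; under eq_fun do rewrite expr2; apply: cvgM; exact: hh.
  - exact: igM.
  - apply: aeW => x n _; rewrite /= lee_fin normrM ler_wpM2l//.
    rewrite normrX ler_sqr ?nnegrE//.
    by rewrite (le_trans _ (hM n x)).
  move=> ih _; rewrite -[X in _ --> X]fineK ?integrable_fin_num//.
  move=> /fine_cvg cv; apply: (cvgr_to_ge cv).
  by apply: nearW => n; exact: h0.
pose E := [set x | g x < 0].
have mg : measurable_fun setT g by apply/measurable_EFinP/(measurable_int mu).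
have mE : measurable E.
  by rewrite -[E]setTI; apply: measurable_fun_ltr => //; exact: measurable_cst.
have igE : mu.-integrable setT (EFin \o (fun x => g x * \1_E x)).
  apply: (@integrableM_bounded _ _ 1) => // x.
  by rewrite indicE; case: (_ \in _); rewrite ?normr1 ?normr0.
have gE x : `|g x * \1_E x| = - (g x * \1_E x).
  rewrite indicE; case: (boolP (x \in E)); last by rewrite mulr0 normr0 oppr0.
  by rewrite inE /E/= => gx; rewrite mulr1 ltr0_norm.
(* As the indicator is its own square, the test gives a nonnegative integral of [g] over a set where
   [g] is negative; that integral must vanish. *)
have gE2 x : g x * \1_E x ^+ 2 = g x * \1_E x.
  by rewrite indicE; case: (_ \in _); rewrite ?expr1n// expr0n.
have gE0 : \int[mu]_x (g x * \1_E x) = 0.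
  apply/eqP; rewrite eq_le; apply/andP; split.
    rewrite -oppr_ge0 -mulN1r -RintegralZl//; apply: Rintegral_ge0 => x _.
    by rewrite mulN1r -gE.
  by have := clg _ (bpclosure_indic mE); under eq_Rintegral do rewrite gE2.
have : (\int[mu]_x `|(g x * \1_E x)%:E|)%E = 0%E.
  under eq_integral => x _ do rewrite abse_EFin gE.
  have iN : mu.-integrable setT (EFin \o (fun x => - (g x * \1_E x))).
    by have := integrableN igE.
  rewrite -[LHS]fineK ?integrable_fin_num//.
  have := @RintegralZl _ _ _ mu setT _ (-1) measurableT igE.
  rewrite gE0 mulr0 /Rintegral => h; congr EFin; rewrite -[RHS]h; congr fine.
  by apply: eq_integral => x _; rewrite mulN1r.
move/ae_eq_integral_abs => -/(_ measurableT (measurable_int mu igE)).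
apply: filterS => x /(_ Logic.I) /= [gx]; rewrite leNgt; apply/negP => xE.
by move: gx; rewrite indicE mem_set// mulr1 => gx; rewrite gx ltxx in xE.
Qed.

End square_test.

(** * Trigonometric polynomials *)

Section trigonometric_polynomials.
Context {R : realType}.
Implicit Types (z : circle R) (p : {poly R[i]}) (h : circle R -> R).

Lemma normc_cval z : Normc.normc (cval z) = 1.
Proof. by have /eqP := cvalP z; case: (cval z) => a b [h]; exact: h. Qed.

Lemma normc_cval_expn z n : Normc.normc (cval z ^+ n) = 1.
Proof.
elim: n => [|n ih]; first by rewrite Normc.normc1.
by rewrite exprS Normc.normcM ih mulr1 normc_cval.
Qed.

Lemma cval_conj z : cval z * conjc (cval z) = 1.
Proof. by rewrite -sqr_normc; have /eqP -> := cvalP z; rewrite expr1n. Qed.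

Lemma cval_neq0 z : cval z != 0.
Proof.
apply/eqP => z0; have := cval_conj z; rewrite z0 mul0r => /eqP.
by rewrite eq_sym oner_eq0.
Qed.

Lemma conj_cval z : conjc (cval z) = (cval z)^-1.
Proof. by apply: (mulfI (cval_neq0 z)); rewrite cval_conj mulfV ?cval_neq0. Qed.

Lemma conj_exp_cval z (n : int) : conjc (cval z ^ n) = cval z ^ (- n).
Proof.
rewrite -[conjc _]/((conjc : {rmorphism R[i] -> R[i]}) _).
by rewrite rmorphXz ?unitfE ?cval_neq0//= conj_cval exprz_inv.
Qed.

Lemma cmeasurable_poly p : cmeasurable (fun z : circle R => p.[cval z]).
Proof.
elim/poly_ind: p => [|p c ih].
  by under eq_fun do rewrite horner0; exact: cmeasurable_cst.
under eq_fun do rewrite hornerMXaddC.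
apply: cmeasurableD (cmeasurable_cst _).
exact: cmeasurableM ih cmeasurable_cval.
Qed.

Lemma poly_circle_bounded p : exists M, forall z, Normc.normc p.[cval z] <= M.
Proof.
elim/poly_ind: p => [|p c [M pM]].
  by exists 0 => z; rewrite horner0 Normc.normc0.
exists (M + Normc.normc c) => z; rewrite hornerMXaddC.
by rewrite (le_trans (le_normcD _ _))// lerD2r Normc.normcM normc_cval mulr1.
Qed.

(** Real trigonometric polynomials, written without negative powers: multiplication by [z^N] clears
    them. Since [|z^N| = 1], this also gives [|h| = |p|] on the circle, the link with analytic
    polynomials. *)
Definition trig_poly h :=
  exists N p, forall z, p.[cval z] = cval z ^+ N * (h z)%:C%C.

Lemma trig_poly_cst c : trig_poly (fun=> c).
Proof. by exists 0%N, (c%:C%C)%:P => z; rewrite hornerC expr0 mul1r. Qed.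

Lemma trig_polyD h k : trig_poly h -> trig_poly k -> trig_poly (fun z => h z + k z).
Proof.
move=> [N [p ph]] [M [q qk]]; exists (N + M)%N, ('X^M * p + 'X^N * q) => z.
by rewrite !(hornerE, hornerXn) ph qk rmorphD/= exprD; ring.
Qed.

Lemma trig_polyM h k : trig_poly h -> trig_poly k -> trig_poly (fun z => h z * k z).
Proof.
move=> [N [p ph]] [M [q qk]]; exists (N + M)%N, (p * q) => z.
by rewrite hornerM ph qk rmorphM/= exprD; ring.
Qed.

Lemma trig_poly_Re : trig_poly (fun z => complex.Re (cval z)).
Proof.
exists 1%N, (2^-1 *: ('X^2 + 1)) => z; rewrite !(hornerE, hornerXn) expr1.
by rewrite ReJ_add -[X in _ * (_ + X)](cval_conj z); field.
Qed.

Lemma trig_poly_Im : trig_poly (fun z => complex.Im (cval z)).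
Proof.
exists 1%N, ((2^-1 * 'i%C) *: (1 - 'X^2)) => z; rewrite !(hornerE, hornerXn) expr1.
by rewrite ImJ_sub -[X in _ * (X - _)](cval_conj z); field.
Qed.

Lemma trig_poly_normc h : trig_poly h ->
  exists p, forall z, Normc.normc p.[cval z] = `|h z|.
Proof.
move=> [N [p ph]]; exists p => z.
by rewrite ph Normc.normcM normc_cval_expn mul1r /Normc.normc /= expr0n addr0 sqrtr_sqr.
Qed.

Lemma trig_poly_bounded h : trig_poly h -> exists M, forall z, `|h z| <= M.
Proof.
move=> /trig_poly_normc[p hp]; have [M pM] := poly_circle_bounded p.
by exists M => z; rewrite -hp.
Qed.

Lemma measurable_trig_poly h : trig_poly h -> measurable_fun setT h.
Proof.
move=> [N [p ph]].
have [+ _] := cmeasurableM (cmeasurable_poly p) (cmeasurable_exp (- N%:Z)).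
congr measurable_fun; apply/funext => z.
by rewrite ph mulrAC exprnP -expfzDr ?cval_neq0// subrr expr0z mul1r.
Qed.

(** Subtracting constants turns the sets [0 < h] into all sets [c < h], so trigonometric polynomials
    are measurable for the generated sigma-algebra. Real and imaginary parts are among them, and the
    Borel sets of the circle are the preimages under these two coordinates. *)
Lemma measurable_circle_trig_poly :
  @measurable _ (circle R) `<=` <<s [set [set z | 0 < h z] | h in trig_poly] >>.
Proof.
set G := [set _ | _ in _].
have mG h : trig_poly h ->
    measurable_fun setT (h : g_sigma_algebraType G -> R).
  move=> hT; apply: (measurability _ (RGenOInfty.measurableE R)) => //.
  move=> _ [_ [c ->] <-]; rewrite setTI; apply: sub_sigma_algebra.
  exists (fun z => h z + - c).
    exact: trig_polyD hT (trig_poly_cst _).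
  by apply/seteqP; split => z /=; rewrite in_itv/= andbT subr_gt0.
have mcoord : measurable_fun setT (@circle_coord R : g_sigma_algebraType G -> R * R).
  apply/measurable_fun_pairP; split.
    exact: mG trig_poly_Re.
  exact: mG trig_poly_Im.
by move=> _ [B mB <-]; exact: mcoord.
Qed.

Lemma ae_ge0_trig_poly (g : circle R -> R) :
  circle_prob.-integrable setT (EFin \o g) ->
  (forall h, trig_poly h -> 0 <= \int[circle_prob]_z (g z * h z ^+ 2)) ->
  \forall z \ae circle_prob, 0 <= g z.
Proof.
exact: (@ae_ge0_square_test _ _ _ circle_prob trig_poly g trig_poly_bounded
  trig_poly_cst trig_polyD trig_polyM measurable_trig_poly
  measurable_circle_trig_poly).
Qed.

End trigonometric_polynomials.

(** * The inner product of L2 *)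

Section complex_integral.
Context {R : realType}.
Implicit Types (f g : circle R -> R[i]).

(* [rmorphD conjc] followed by [/=] would compute [inner] down to a pair. *)
Lemma conjcD (x y : R[i]) : conjc (x + y) = conjc x + conjc y.
Proof. exact: rmorphD. Qed.

Lemma conjcN (x : R[i]) : conjc (- x) = - conjc x.
Proof. exact: rmorphN. Qed.

Lemma conjcM (x y : R[i]) : conjc (x * y) = conjc x * conjc y.
Proof. exact: rmorphM. Qed.

Lemma sqr_normcE (x : R[i]) :
  Normc.normc x ^+ 2 = complex.Re x ^+ 2 + complex.Im x ^+ 2.
Proof. by case: x => a b; rewrite sqr_sqrtr// addr_ge0// sqr_ge0. Qed.

Lemma mulcJ_normc (x : R[i]) : x * conjc x = (Normc.normc x ^+ 2)%:C%C.
Proof.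
rewrite sqr_normcE; case: x => a b; apply/eqP.
by rewrite eq_complex/=; apply/andP; split; apply/eqP; ring.
Qed.

Lemma normc_conj (x : R[i]) : Normc.normc (conjc x) = Normc.normc x.
Proof. by case: x => a b /=; rewrite sqrrN. Qed.

Lemma Re_le_normc (x : R[i]) : `|complex.Re x| <= Normc.normc x.
Proof.
by rewrite -ler_sqr ?nnegrE ?normc_ge0// sqr_normcE real_normK ?num_real// lerDl sqr_ge0.
Qed.

Lemma Im_le_normc (x : R[i]) : `|complex.Im x| <= Normc.normc x.
Proof.
by rewrite -ler_sqr ?nnegrE ?normc_ge0// sqr_normcE real_normK ?num_real// lerDr sqr_ge0.
Qed.

Definition cintegrable f :=
  circle_prob.-integrable setT (EFin \o (fun z => complex.Re (f z))) /\
  circle_prob.-integrable setT (EFin \o (fun z => complex.Im (f z))).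

Lemma cintegrable_le f (b : circle R -> R) : cmeasurable f ->
  circle_prob.-integrable setT (EFin \o b) -> (forall z, Normc.normc (f z) <= b z) ->
  cintegrable f.
Proof.
move=> [mf1 mf2] ib fb; split.
  apply: (le_integrable measurableT) ib; first exact/measurable_EFinP.
  move=> z _; rewrite /= lee_fin (le_trans (Re_le_normc _))//.
  by rewrite (le_trans (fb z))// ler_norm.
apply: (le_integrable measurableT) ib; first exact/measurable_EFinP.
move=> z _; rewrite /= lee_fin (le_trans (Im_le_normc _))//.
by rewrite (le_trans (fb z))// ler_norm.
Qed.

Lemma cintegralD f g : cintegrable f -> cintegrable g ->
  cintegral (fun z => f z + g z) = cintegral f + cintegral g.
Proof.
move=> [f1 f2] [g1 g2]; rewrite /cintegral.
rewrite -[RHS]/(Complex (_ + _) (_ + _)) -!RintegralD//.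
by congr Complex; apply: eq_Rintegral => z _; case: (f z); case: (g z).
Qed.

Lemma cintegralZ (a : R[i]) f : cintegrable f ->
  cintegral (fun z => a * f z) = a * cintegral f.
Proof.
move=> [f1 f2]; rewrite /cintegral; case: a => x y.
rewrite -[RHS]/(Complex (_ - _) (_ + _)) -!RintegralZl//.
have iZ (r : R) (h : circle R -> R) : circle_prob.-integrable setT (EFin \o h) ->
    circle_prob.-integrable setT (EFin \o (fun z => r * h z)).
  by move=> ih; have := integrableZl measurableT r ih.
rewrite -RintegralB ?iZ// -RintegralD ?iZ//.
by congr Complex; apply: eq_Rintegral => z _; case: (f z).
Qed.

Lemma cintegral_conj f : cintegrable f ->
  cintegral (fun z => conjc (f z)) = conjc (cintegral f).
Proof.
move=> [f1 f2]; rewrite /cintegral /=; congr Complex.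
  by apply: eq_Rintegral => z _; case: (f z).
rewrite -mulN1r -RintegralZl//.
by apply: eq_Rintegral => z _; rewrite mulN1r; case: (f z).
Qed.

Lemma cintegral_RC (h : circle R -> R) :
  cintegral (fun z => (h z)%:C%C) = (\int[circle_prob]_z h z)%:C%C.
Proof. by congr Complex; rewrite /= Rintegral_cst// mul0r. Qed.

End complex_integral.

Section Lp_elements.
Context {R : realType}.
Implicit Types (f g : LpFun (R:=R) le1_2) (a : LpFun (R:=R) le1_oo).

Lemma Lp_cmeasurable p (p1 : (1 <= p)%E) (f : LpFun (R:=R) p1) : cmeasurable f.
Proof. by have /Lp_predP[] := lpfunP f. Qed.

Lemma L2_integrable_sqr f :
  circle_prob.-integrable setT (EFin \o (fun z => cabs f z ^+ 2)).
Proof. by have /Lp_predP/cabs_Lfun/Lfun2_integrable_sqr := lpfunP f. Qed.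

Lemma in_L2P (f : circle R -> R[i]) : cmeasurable f ->
  circle_prob.-integrable setT (EFin \o (fun z => cabs f z ^+ 2)) ->
  f \in Lp_pred_of (R:=R) le1_2.
Proof.
move=> mf ff; apply/Lp_predP; split=> //.
have := integrable_lty measurableT ff.
rewrite /finite_norm unlock /= => h; apply: poweR_lty.
rewrite (le_lt_trans _ h)// le_eqVlt; apply/orP; left; apply/eqP.
by apply: eq_integral => z _ /=; rewrite powR_mulrn ?normr_ge0// ger0_norm ?cabs_ge0.
Qed.

Lemma in_LooP (f : circle R -> R[i]) M : cmeasurable f ->
  (\forall z \ae circle_prob, Normc.normc (f z) <= M) -> f \in Lp_pred_of (R:=R) le1_oo.
Proof.
move=> mf fM; apply/Lp_predP; split=> //; rewrite /finite_norm unlock /Lnorm.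
rewrite circle_probT lte01; apply: (@le_lt_trans _ _ M%:E); last exact: ltry.
apply/ess_supP; apply: filterS fM => z fz /=.
by rewrite lee_fin ger0_norm ?cabs_ge0.
Qed.

Lemma cintegrable_mul f g (h : circle R -> R[i]) M : cmeasurable h ->
  (forall z, Normc.normc (h z) <= M) ->
  cintegrable (fun z => h z * (f z * conjc (g z))).
Proof.
move=> mh hM.
(* The dominating function comes from [2 |f g| <= |f|^2 + |g|^2]. *)
apply: (@cintegrable_le _ _ (fun z => M * (cabs f z ^+ 2 + cabs g z ^+ 2))).
- apply: cmeasurableM mh _; apply: cmeasurableM; first exact: Lp_cmeasurable.
  exact/cmeasurable_conj/Lp_cmeasurable.
- have := integrableD measurableT (L2_integrable_sqr f) (L2_integrable_sqr g).
  by move/(integrableZl measurableT M).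
- move=> z; rewrite !Normc.normcM normc_conj ler_pM ?mulr_ge0 ?normc_ge0//.
  rewrite -/(cabs f z) -/(cabs g z).
  have := sqr_ge0 (cabs f z - cabs g z); have := cabs_ge0 f z; have := cabs_ge0 g z.
  by nra.
Qed.

Lemma cintegrable_inner f g : cintegrable (fun z => f z * conjc (g z)).
Proof.
rewrite (_ : (fun _ => _) = (fun z => 1 * (f z * conjc (g z)))).
  apply: (@cintegrable_mul f g (fun=> 1) 1) => [|z].
    exact: cmeasurable_cst.
  by rewrite Normc.normc1.
by apply/funext => z; rewrite mul1r.
Qed.

Lemma pi_L2D f g : (\pi_(L2 R) (f + g) = \pi_(L2 R) f + \pi_(L2 R) g)%qT.
Proof. exact: (raddfD (\pi_(L2 R))%qT). Qed.

Lemma pi_L2B f g : (\pi_(L2 R) (f - g) = \pi_(L2 R) f - \pi_(L2 R) g)%qT.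
Proof. exact: (raddfB (\pi_(L2 R))%qT). Qed.

Lemma pi_Lp0 p (p1 : (1 <= p)%E) : (\pi_(Lp (R:=R) p1) 0 = 0)%qT.
Proof. exact: (raddf0 (\pi_(Lp (R:=R) p1))%qT). Qed.

Lemma pi_L2Z c f : (\pi_(L2 R) (c *: f) = c *: \pi_(L2 R) f)%qT.
Proof. by rewrite -[RHS]/(Lp_scale _ _) pi_Lp_scale. Qed.

End Lp_elements.

(** * Moments of the circle measure *)

Section circle_moments.
Context {R : realType}.

Lemma cexp_expn (t : R) n :
  cval (cexp t) ^+ n = Complex (cos (n%:R * t)) (sin (n%:R * t)).
Proof.
elim: n => [|n ih]; first by rewrite expr0 mul0r cos0 sin0.
rewrite exprS ih -natr1 mulrDl mul1r cosD sinD.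
by apply/eqP; rewrite eq_complex/=; apply/andP; split; apply/eqP; ring.
Qed.

Lemma cexp_2pi : cexp (pi *+ 2) = cexp 0 :> circle R.
Proof. by apply: val_inj; rewrite /= cos2pi sin2pi cos0 sin0. Qed.

(* The hypothesis [F' = 1 + h] with [1 + h >= 0] fits [integral_uniform], which
   is stated for nonnegative functions. *)
Lemma integral_circle_derive (h : circle R -> R) (F : R -> R) :
  measurable_fun setT h -> (forall z, `|h z| <= 1) ->
  continuous (h \o cexp) ->
  (forall t : R, is_derive t 1 F (1 + h (cexp t))) ->
  F (pi *+ 2) - F 0 = pi *+ 2 ->
  \int[circle_prob]_z h z = 0.
Proof.
move=> mh h1 ch dF FF.
have h1ge0 z : 0 <= 1 + h z by have := h1 z; rewrite ler_norml => /andP[]; lra.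
have ih : circle_prob.-integrable setT (EFin \o h).
  apply: measurable_bounded_integrable => //; first by rewrite circle_probT ltry.
  exists 1; split; first exact: num_real.
  by move=> M M1 z _; exact: le_trans (h1 z) (ltW M1).
have i1 : circle_prob.-integrable setT (EFin \o (fun=> 1 : R)).
  by apply: finite_measure_integrable_cst.
have : (\int[circle_prob]_z (1 + h z)%:E)%E = 1%E.
  have mh1 : measurable_fun setT (fun z => (1 + h z)%:E).
    by apply/measurable_EFinP; exact: measurable_funD.
  rewrite (ge0_integral_distribution _ mh1); last by move=> z; rewrite lee_fin.
  have pi2 : 0 < pi *+ 2 :> R by exact: tau_gt0.
  rewrite (integral_uniform _ (measurableT_comp mh1 measurable_cexp)); last first.
    by move=> t; rewrite lee_fin.
  rewrite (@continuous_FTC2 _ (fun t => 1 + h (cexp t)) F)//.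
  - by rewrite -EFinB FF subr0 -EFinM mulVf ?gt_eqF.
  - apply: continuous_subspaceT => t.
    by apply: cvgD; [exact: cvg_cst|exact: ch].
  - have cF t : {for t, continuous F}.
      by apply/differentiable_continuous/derivable1_diffP; have [] := dF t.
    split; first by move=> t _; have [] := dF t.
      exact: cvg_at_right_filter (cF _).
    exact: cvg_at_left_filter (cF _).
  - by move=> t _; rewrite derive1E; have [_] := dF t.
move=> /(congr1 fine); rewrite -/(Rintegral circle_prob setT (fun z => 1 + h z)).
rewrite RintegralD// Rintegral_cst// circle_probT /= mulr1 => /eqP.
by rewrite -[X in _ == X]addr0 => /eqP/addrI.
Qed.

Lemma cintegral_cval_expn n : (0 < n)%N ->
  cintegral (fun z : circle R => cval z ^+ n) = 0.
Proof.
move=> n0; have n1 : n%:R != 0 :> R by rewrite pnatr_eq0 -lt0n.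
have [m1 m2] := cmeasurable_exp (R:=R) n%:Z.
have cexpn2pi : cval (cexp (pi *+ 2 : R)) ^+ n = 1.
  by rewrite cexp_2pi cexp_expn mulr0 cos0 sin0.
rewrite cexp_expn in cexpn2pi; case: cexpn2pi => c2pi s2pi.
apply/eqP; rewrite eq_complex/=; apply/andP; split; apply/eqP.
(* A primitive of [1 + cos (n t)]; its periodic part contributes nothing over a full turn, so the
   increment is that of [t]. *)
- apply: (@integral_circle_derive _ (fun t => t + n%:R^-1 * sin (n%:R * t))) => //.
  + by move=> z; rewrite -(normc_cval_expn z n); exact: Re_le_normc.
  + rewrite (_ : _ \o _ = (fun t : R => cos (n%:R * t))).
      move=> t; apply: continuous_comp; last exact: continuous_cos.
      by apply: cvgMl_tmp.
    by apply/funext => t /=; rewrite cexp_expn.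
  + move=> t; rewrite cexp_expn/=.
    apply: is_derive_eq; rewrite /= /GRing.scale/=; by field.
  + by rewrite s2pi !mulr0 sin0; ring.
- apply: (@integral_circle_derive _ (fun t => t - n%:R^-1 * cos (n%:R * t))) => //.
  + by move=> z; rewrite -(normc_cval_expn z n); exact: Im_le_normc.
  + rewrite (_ : _ \o _ = (fun t : R => sin (n%:R * t))).
      move=> t; apply: continuous_comp; last exact: continuous_sin.
      by apply: cvgMl_tmp.
    by apply/funext => t /=; rewrite cexp_expn.
  + move=> t; rewrite cexp_expn/=.
    apply: is_derive_eq; rewrite /= /GRing.scale/=; by field.
  + by rewrite c2pi mulr0 cos0; ring.
Qed.

End circle_moments.

(** * Inner product, multiplication operators and exponentials *)

Section L2_structure.
Context {R : realType}.
Implicit Types (f g h : L2 R) (a b : Linf R).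

Lemma eq_piLp p (p1 : (1 <= p)%E) (u v : LpFun (R:=R) p1) :
  (forall z, u z = v z) -> (\pi_(Lp (R:=R) p1) u = \pi_(Lp (R:=R) p1) v)%qT.
Proof. by move=> uv; congr (\pi_(Lp _) _)%qT; apply/val_inj/funext. Qed.

Lemma innerDl f g h : inner (f + g) h = inner f h + inner g h.
Proof.
rewrite -[f]reprK -[g]reprK -[h]reprK -pi_L2D !pi_inner.
rewrite -cintegralD; [|exact: cintegrable_inner..].
by congr cintegral; apply/funext => z; rewrite -mulrDl.
Qed.

Lemma innerZl c f g : inner (c *: f) g = c * inner f g.
Proof.
rewrite -[f]reprK -[g]reprK -pi_L2Z !pi_inner.
rewrite -cintegralZ; last exact: cintegrable_inner.
by congr cintegral; apply/funext => z; rewrite mulrA.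
Qed.

Lemma inner_conj f g : inner f g = conjc (inner g f).
Proof.
rewrite -cintegral_conj; last exact: cintegrable_inner.
by congr cintegral; apply/funext => z; rewrite conjcM conjcK mulrC.
Qed.

Lemma innerDr f g h : inner f (g + h) = inner f g + inner f h.
Proof. by rewrite inner_conj innerDl conjcD -!inner_conj. Qed.

Lemma innerZr c f g : inner f (c *: g) = conjc c * inner f g.
Proof. by rewrite inner_conj innerZl conjcM -inner_conj. Qed.

Lemma innerNl f g : inner (- f) g = - inner f g.
Proof. by rewrite -scaleN1r innerZl mulN1r. Qed.

Lemma innerNr f g : inner f (- g) = - inner f g.
Proof. by rewrite inner_conj innerNl conjcN -inner_conj. Qed.

Lemma inner0l f : inner 0 f = 0.
Proof. by rewrite -(scale0r f) innerZl mul0r. Qed.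

Lemma inner_suml (I : Type) (r : seq I) (P : pred I) (F : I -> L2 R) g :
  inner (\sum_(i <- r | P i) F i) g = \sum_(i <- r | P i) inner (F i) g.
Proof.
by elim/big_rec2: _ => [|i x y _ <-]; rewrite ?inner0l// innerDl.
Qed.

(** The square of [L2norm], as [L2norm_sqr] shows; all estimates are made on it, since it is the
    diagonal of [inner] and involves no root. *)
Definition normsq f : R := \int[circle_prob]_z (cabs (repr f) z ^+ 2).

Lemma inner_normsq f : inner f f = (normsq f)%:C%C.
Proof.
rewrite /inner -cintegral_RC.
by congr cintegral; apply/funext => z; rewrite mulcJ_normc.
Qed.

Lemma pi_normsq (u : LpFun (R:=R) le1_2) :
  normsq (\pi_(L2 R) u)%qT = \int[circle_prob]_z (cabs u z ^+ 2).
Proof.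
apply: complexI; rewrite -inner_normsq pi_inner -cintegral_RC.
by congr cintegral; apply/funext => z; rewrite mulcJ_normc.
Qed.

Lemma normsq_ge0 f : 0 <= normsq f.
Proof. by apply: Rintegral_ge0 => z _; exact: sqr_ge0. Qed.

Lemma L2norm_sqr f : L2norm f ^+ 2 = normsq f.
Proof.
rewrite /L2norm /normsq -powR_mulrn ?fine_ge0 ?Lnorm_ge0// -fine_poweR.
rewrite poweR_Lnorm ?pnatr_eq0//; congr fine; apply: eq_integral => z _ /=.
by rewrite powR_mulrn ?normr_ge0// ger0_norm ?cabs_ge0.
Qed.

Lemma L2norm_ge0 f : 0 <= L2norm f.
Proof. by rewrite fine_ge0// Lnorm_ge0. Qed.

Lemma normsqD f g : normsq (f + g) = normsq f + normsq g + 2 * complex.Re (inner f g).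
Proof.
have -> : normsq (f + g) = complex.Re (inner (f + g) (f + g)) by rewrite inner_normsq.
rewrite innerDl !innerDr !inner_normsq (inner_conj g f).
by case: (inner f g) => x y /=; ring.
Qed.

Lemma normsqZ c f : normsq (c *: f) = Normc.normc c ^+ 2 * normsq f.
Proof.
apply: complexI; rewrite -inner_normsq innerZl innerZr mulrA mulcJ_normc.
by rewrite inner_normsq; exact/esym/rmorphM.
Qed.

Lemma normsqN f : normsq (- f) = normsq f.
Proof. by apply: complexI; rewrite -!inner_normsq innerNl innerNr opprK. Qed.

(** This replaces continuity of the inner product in density arguments. It is enough to bound the
    real part above by 0: multiplying [h] and [k] by -1, [i] and [-i] then handles the other three
    directions. *)
Lemma inner_eq0_approx2 (v : R[i]) h k :
  (forall e, 0 < e -> exists r s,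
    [/\ normsq r <= e, normsq s <= e & inner r h + inner s k = v]) -> v = 0.
Proof.
move=> hv.
have Re0 (w : R[i]) h' k' :
    (forall e, 0 < e -> exists r s,
      [/\ normsq r <= e, normsq s <= e & inner r h' + inner s k' = w]) ->
    complex.Re w <= 0.
  move=> hw; rewrite leNgt; apply/negP => w0.
  pose c := normsq h' + normsq k'.
  have c0 : 0 <= c by rewrite addr_ge0// normsq_ge0.
  (* With this [t], [t * Re w] is [2 + c], whereas the positivity of [|h' - t r|^2] and
     [|k' - t s|^2] yields [2 t Re w <= 2 + c]. *)
  pose t := (2 + c) / complex.Re w.
  have t0 : 0 < t by rewrite divr_gt0// ltr_pwDl.
  have [|r [s [re se rw]]] := hw (t ^- 2); first by rewrite invr_gt0 exprn_gt0.
  have tsq (x : L2 R) : normsq x <= t ^- 2 -> t ^+ 2 * normsq x <= 1.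
    move=> xt; rewrite -(@divff _ (t ^+ 2)) ?ler_pM2l// ?exprn_gt0//.
    by rewrite expf_neq0// gt_eqF.
  have pos (x y : L2 R) :
      0 <= t ^+ 2 * normsq x + normsq y - 2 * (t * complex.Re (inner x y)).
    have := normsq_ge0 ((- t)%:C%C *: x + y); rewrite normsqD normsqZ innerZl sqr_normcE.
    rewrite /= expr0n/= addr0 sqrrN.
    by case: (inner x y) => p q /=; congr (0 <= _); ring.
  have := pos r h'; have := pos s k'; have := tsq _ re; have := tsq _ se.
  have : t * complex.Re w = 2 + c by rewrite divfK// gt_eqF.
  rewrite -rw [complex.Re (_ + _)]raddfD/= mulrDr /c.
  by move: c0; rewrite /c; lra.
have Re0' : complex.Re v = 0.
  apply/eqP; rewrite eq_le (Re0 _ h k)//= -oppr_le0.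
  rewrite [leLHS](_ : _ = complex.Re (- v)); last by case: (v).
  apply: (Re0 _ (- h) (- k)) => e /hv[r [s [re se <-]]].
  by exists r, s; split => //; rewrite !innerNr opprD.
have Im0' : complex.Im v = 0.
  apply/eqP; rewrite eq_le; apply/andP; split.
    rewrite [leLHS](_ : _ = complex.Re (conjc 'i%C * v)); last first.
      by case: (v) => x y /=; ring.
    apply: (Re0 _ ('i%C *: h) ('i%C *: k)) => e /hv[r [s [re se <-]]].
    by exists r, s; split => //; rewrite !innerZr mulrDr.
  rewrite -oppr_le0.
  rewrite [leLHS](_ : _ = complex.Re (conjc (- 'i%C) * v)); last first.
    by case: (v) => x y /=; ring.
  apply: (Re0 _ (- 'i%C *: h) (- 'i%C *: k)) => e /hv[r [s [re se <-]]].
  by exists r, s; split => //; rewrite !innerZr mulrDr.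
by apply/eqP; rewrite eq_complex Re0' Im0' !eqxx.
Qed.

Lemma inner_eq0_approx (v : R[i]) h :
  (forall e, 0 < e -> exists2 r, normsq r <= e & inner r h = v) -> v = 0.
Proof.
move=> hv; apply: (@inner_eq0_approx2 v h 0) => e e0; have [r re rv] := hv e e0.
exists r, 0; split => //; last by rewrite inner0l addr0.
rewrite (_ : normsq 0 = 0) ?ltW//.
by apply: complexI; rewrite -inner_normsq inner0l.
Qed.

Lemma linear_fun0 (T : L2 R -> L2 R) : linear T -> T 0 = 0.
Proof.
move=> lT; have := lT 1 0 0; rewrite !scale1r !addr0.
by move/eqP; rewrite -subr_eq0 opprD addrA subrr add0r oppr_eq0 => /eqP.
Qed.

Lemma Linf_mul_linear a : linear (Linf_mul a).
Proof.
move=> c f g; rewrite -[a]reprK -[f]reprK -[g]reprK -pi_L2Z -pi_L2D !pi_Linf_mul.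
rewrite -pi_L2Z -pi_L2D; apply: eq_piLp => z.
by rewrite -[LHS]/(_ * (c * _ + _)) mulrDr mulrCA.
Qed.

Lemma Linf_mulr0 a : Linf_mul a 0 = 0.
Proof. exact/linear_fun0/Linf_mul_linear. Qed.

Lemma Linf_mul0 f : Linf_mul 0 f = 0.
Proof.
rewrite -[f]reprK -[0 in LHS]pi_Lp0 pi_Linf_mul -[RHS]pi_Lp0.
by apply: eq_piLp => z; rewrite /= mul0r.
Qed.

Lemma Linf_mulCA a b f : Linf_mul a (Linf_mul b f) = Linf_mul b (Linf_mul a f).
Proof.
rewrite -[a]reprK -[b]reprK -[f]reprK !(pi_Linf_mul _ (repr f)) !pi_Linf_mul.
by apply: eq_piLp => z; exact: mulrCA.
Qed.

Lemma inner_Linf_mul a f g :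
  inner (Linf_mul a f) g = inner f (Linf_mul (Lp_conj a) g).
Proof.
rewrite -[a]reprK -[f]reprK -[g]reprK pi_Lp_conj !pi_Linf_mul !pi_inner.
congr cintegral; apply/funext => z /=.
by rewrite conjcM conjcK mulrCA mulrA.
Qed.

Lemma Lp_conjK p (p1 : (1 <= p)%E) : involutive (@Lp_conj R p p1).
Proof.
move=> f; rewrite -[f]reprK (pi_Lp_conj (repr f)) pi_Lp_conj.
by apply: eq_piLp => z; exact: conjcK.
Qed.

Fact exp_Linf_subproof (n : int) :
  (fun z : circle R => cval z ^ n) \in Lp_pred_of (R:=R) le1_oo.
Proof.
apply: (@in_LooP _ _ 1); first exact: cmeasurable_exp.
apply: aeW => z; case: n => n; first by rewrite -exprnP normc_cval_expn.
by rewrite NegzE -exprnN Normc.normcV normc_cval_expn invr1.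
Qed.

Definition exp_Linf (n : int) : Linf R :=
  (\pi_(Linf R) (MkLpFun (exp_Linf_subproof n)))%qT.

Definition exp_L2 (n : int) : L2 R := Linf_L2 (exp_Linf n).

Lemma z_LinfE : z_Linf = exp_Linf 1.
Proof. by apply: eq_piLp. Qed.

Lemma conj_exp_Linf n : Lp_conj (exp_Linf n) = exp_Linf (- n).
Proof. by rewrite pi_Lp_conj; apply: eq_piLp => z /=; rewrite conj_exp_cval. Qed.

Lemma zbar_LinfE : zbar_Linf = exp_Linf (-1).
Proof. by rewrite /zbar_Linf z_LinfE conj_exp_Linf. Qed.

Lemma exp_Linf_mul m n f :
  Linf_mul (exp_Linf m) (Linf_mul (exp_Linf n) f) = Linf_mul (exp_Linf (m + n)) f.
Proof.
rewrite -[f]reprK !(pi_Linf_mul _ (repr f)) !pi_Linf_mul; apply: eq_piLp => z /=.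
by rewrite mulrA expfzDr ?cval_neq0.
Qed.

Lemma exp_Linf0_mul f : Linf_mul (exp_Linf 0) f = f.
Proof.
by rewrite -[f]reprK pi_Linf_mul; apply: eq_piLp => z /=; rewrite expr0z mul1r.
Qed.

Lemma exp_Linf_L2 m n : Linf_mul (exp_Linf m) (exp_L2 n) = exp_L2 (m + n).
Proof.
rewrite /exp_L2 !pi_Linf_L2 pi_Linf_mul; apply: eq_piLp => z /=.
by rewrite expfzDr ?cval_neq0.
Qed.

Lemma Linf_mul_exp_L2 a n : Linf_mul a (exp_L2 n) = Linf_mul (exp_Linf n) (Linf_L2 a).
Proof.
rewrite /exp_L2 -[a]reprK !pi_Linf_L2 !pi_Linf_mul; apply: eq_piLp => z /=.
by rewrite mulrC.
Qed.

Lemma fourierE f n : fourier f n = inner f (exp_L2 n).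
Proof. by rewrite /exp_L2 pi_Linf_L2 -[f]reprK pi_fourier pi_inner. Qed.

Lemma inner_exp_L2 m n : inner (exp_L2 m) (exp_L2 n) = (m == n)%:R.
Proof.
have pos (k : nat) : cintegral (fun z : circle R => cval z ^+ k) = (k == 0%N)%:R.
  case: k => [|k]; last exact: cintegral_cval_expn.
  by apply/eqP; rewrite eq_complex/= !Rintegral_cst// circle_probT mul0r mulr1 !eqxx.
rewrite /exp_L2 !pi_Linf_L2 pi_inner /=.
have -> : (fun z : circle R => cval z ^ m * conjc (cval z ^ n)) =
    (fun z => cval z ^ (m - n)).
  by apply/funext => z; rewrite conj_exp_cval expfzDr ?cval_neq0.
rewrite -(subr_eq0 m n); case: (m - n) => k; first exact: pos.
have -> : (fun z : circle R => cval z ^ Negz k) = (fun z => conjc (cval z ^+ k.+1)).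
  by apply/funext => z; rewrite exprnP conj_exp_cval NegzE.
rewrite cintegral_conj ?pos ?conjc0//.
apply: (@cintegrable_le _ _ (fun=> 1)); first exact: (cmeasurable_exp k.+1%:Z).
  exact: finite_measure_integrable_cst.
by move=> z; rewrite normc_cval_expn.
Qed.

End L2_structure.

(** * Uniqueness of Fourier coefficients and multipliers *)

Section fourier_uniqueness.
Context {R : realType}.
Implicit Types (f g : L2 R) (p : {poly R[i]}).

Fact poly_Linf_subproof p :
  (fun z : circle R => p.[cval z]) \in Lp_pred_of (R:=R) le1_oo.
Proof.
have [M pM] := poly_circle_bounded p.
by apply: (in_LooP (cmeasurable_poly p)); exact: aeW.
Qed.

Definition poly_Linf p : Linf R := (\pi_(Linf R) (MkLpFun (poly_Linf_subproof p)))%qT.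

Definition poly_L2 p : L2 R := Linf_L2 (poly_Linf p).

Lemma poly_Linf0_mul f : Linf_mul (poly_Linf 0) f = 0.
Proof.
rewrite -[f]reprK pi_Linf_mul -[RHS]pi_Lp0; apply: eq_piLp => z.
by rewrite /= horner0 mul0r.
Qed.

Lemma poly_Linf_mulMXaddC p c f : Linf_mul (poly_Linf (p * 'X + c%:P)) f =
  c *: f + Linf_mul (exp_Linf 1) (Linf_mul (poly_Linf p) f).
Proof.
rewrite -[f]reprK !(pi_Linf_mul _ (repr f)) pi_Linf_mul -pi_L2Z -pi_L2D.
apply: eq_piLp => z; rewrite /= hornerMXaddC.
by rewrite -[RHS]/(c * repr f z + cval z ^+ 1 * (p.[cval z] * repr f z)); ring.
Qed.

Lemma poly_L2E p : poly_L2 p = Linf_mul (poly_Linf p) (exp_L2 0).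
Proof. by rewrite Linf_mul_exp_L2 exp_Linf0_mul. Qed.

Lemma poly_Linf_mul_ind (P : L2 R -> Prop) f :
  P 0 -> (forall c u v, P u -> P v -> P (c *: u + v)) ->
  (forall n : nat, P (Linf_mul (exp_Linf n) f)) ->
  forall p, P (Linf_mul (poly_Linf p) f).
Proof.
move=> P0 Plin Pexp p.
(* The Horner step [p * 'X + c] multiplies by [z], so the induction hypothesis must hold after any
   shift by [z^n]. *)
suff {p} H : forall p (n : nat), P (Linf_mul (exp_Linf n) (Linf_mul (poly_Linf p) f)).
  by rewrite -[Linf_mul _ f]exp_Linf0_mul; exact: (H p 0%N).
elim/poly_ind => [|p c ih] n.
  by rewrite poly_Linf0_mul Linf_mulr0.
rewrite poly_Linf_mulMXaddC Linf_mul_linear exp_Linf_mul.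
by apply: Plin; rewrite // -PoszD addn1; exact: ih.
Qed.

Lemma fourier_exp_Linf_mul m f n :
  fourier (Linf_mul (exp_Linf m) f) n = fourier f (n - m).
Proof. by rewrite !fourierE inner_Linf_mul conj_exp_Linf exp_Linf_L2 addrC. Qed.

(** As [h] is real, the conjugate of [p] on the circle is [z^-N h]. The integral is thus the inner
    product of [z^N f] with [p], a combination of Fourier coefficients of [f]. *)
Lemma inner_trig_poly f (h : circle R -> R) : trig_poly h ->
  (forall n, fourier f n = 0) ->
  cintegral (fun z => repr f z * (h z)%:C%C) = 0.
Proof.
move=> [N [p hp]] f0.
have : inner (Linf_mul (exp_Linf N) f) (poly_L2 p) = 0.
  rewrite poly_L2E.
  apply: (@poly_Linf_mul_ind (fun v => inner (Linf_mul (exp_Linf N) f) v = 0))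
    => [|c u v u0 v0|n].
  - by rewrite inner_conj inner0l conjc0.
  - by rewrite innerDr innerZr u0 v0 mulr0 addr0.
  - by rewrite exp_Linf_L2 addr0 -fourierE fourier_exp_Linf_mul.
move=> <-; rewrite -[f in RHS]reprK pi_Linf_mul /poly_L2 pi_Linf_L2 pi_inner.
congr cintegral; apply/funext => z /=.
rewrite hp conjcM conjc_real exprnP conj_exp_cval mulrACA.
by rewrite -expfzDr ?cval_neq0// subrr expr0z mul1r.
Qed.

(** Squares of trigonometric polynomials are trigonometric polynomials. If [g], the real or
    imaginary part of [f], integrates to 0 against all of these, both [g] and [- g] pass the
    positivity test. *)
Lemma fourier_inj f : (forall n, fourier f n = 0) -> f = 0.
Proof.
move=> f0.
have key (g : circle R -> R) : circle_prob.-integrable setT (EFin \o g) ->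
    (forall h, trig_poly h -> \int[circle_prob]_z (g z * h z) = 0) ->
    \forall z \ae circle_prob, g z = 0.
  move=> ig g0.
  have gp : \forall z \ae circle_prob, 0 <= g z.
    apply: ae_ge0_trig_poly => // h hT.
    by rewrite (g0 (fun z => h z ^+ 2))//; exact: trig_polyM.
  have gn : \forall z \ae circle_prob, 0 <= - g z.
    apply: ae_ge0_trig_poly => [|h hT]; first by have := integrableN ig.
    have hT2 := trig_polyM (trig_poly_cst (-1)) (trig_polyM hT hT).
    rewrite (_ : Rintegral _ _ _ = 0)// -(g0 _ hT2).
    by apply: eq_Rintegral => z _; rewrite expr2; ring.
  apply: filterS2 gp gn => z g1 g2; apply/eqP.
  by rewrite eq_le g1 -oppr_ge0 g2.
(* Integrability of [f] itself: it is a product of two square integrable functions, the second being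
   the constant [z^0]. *)
have [i1 i2] : cintegrable (repr f).
  have := @cintegrable_inner _ (repr f) (LinfFun_L2 (MkLpFun (exp_Linf_subproof 0))).
  congr cintegrable; apply/funext => z.
  by rewrite -[LHS]/(repr f z * conjc 1) conjc1 mulr1.
have h12 h : trig_poly h ->
    \int[circle_prob]_z (complex.Re (repr f z) * h z) = 0 /\
    \int[circle_prob]_z (complex.Im (repr f z) * h z) = 0.
  move=> hT; have fh := inner_trig_poly hT f0; split.
    rewrite -[RHS]/(complex.Re (0 : R[i])) -fh.
    by apply: eq_Rintegral => z _; case: (repr f z) => x y /=; ring.
  rewrite -[RHS]/(complex.Im (0 : R[i])) -fh.
  by apply: eq_Rintegral => z _; case: (repr f z) => x y /=; ring.
have r0 := key _ i1 (fun h hT => (h12 h hT).1).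
have m0 := key _ i2 (fun h hT => (h12 h hT).2).
rewrite -[f]reprK -[RHS]pi_Lp0; apply/eqP/Lp_eqP.
apply: filterS2 r0 m0 => z r0 m0 _; apply/eqP.
by rewrite eq_complex r0 m0 !eqxx.
Qed.

(** The hypothesis says that [M^2 - |f|^2] has a nonnegative integral against every [|p|^2]. Each
    [h^2] with [h] a real trigonometric polynomial is of this form, so the positivity test
    applies. *)
Lemma multiplier_bounded f M :
  (forall p, normsq (Linf_mul (poly_Linf p) f) <= M ^+ 2 * normsq (poly_L2 p)) ->
  exists a, f = Linf_L2 a.
Proof.
move=> fM.
have if2 := L2_integrable_sqr (repr f).
have iM : circle_prob.-integrable setT (EFin \o (fun=> M ^+ 2)).
  exact: finite_measure_integrable_cst.
have ig : circle_prob.-integrable setT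
    (EFin \o (fun z => M ^+ 2 - cabs (repr f) z ^+ 2)).
  by have := integrableB measurableT iM if2.
have g0 : \forall z \ae circle_prob, 0 <= M ^+ 2 - cabs (repr f) z ^+ 2.
  apply: ae_ge0_trig_poly => // h hT.
  have [p hp] := trig_poly_normc hT.
  rewrite (_ : Rintegral _ _ _ = M ^+ 2 * normsq (poly_L2 p) -
      normsq (Linf_mul (poly_Linf p) f)); first by rewrite subr_ge0.
  rewrite -[f in normsq (Linf_mul _ f)]reprK pi_Linf_mul /poly_L2 pi_Linf_L2 !pi_normsq.
  have ip := L2_integrable_sqr (LinfFun_L2 (MkLpFun (poly_Linf_subproof p))).
  rewrite -RintegralZl// -RintegralB//; last 2 first.
  - by have := integrableZl measurableT (M ^+ 2) ip.
  - exact: L2_integrable_sqr.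
  apply: eq_Rintegral => z _; rewrite /cabs /= Normc.normcM hp exprMn.
  by rewrite real_normK ?num_real//; ring.
(* The sign of [M] is unknown, hence the absolute value. *)
have gM : \forall z \ae circle_prob, cabs (repr f) z <= `|M|.
  apply: filterS g0 => z; rewrite subr_ge0 -[M ^+ 2]real_normK ?num_real//.
  by rewrite ler_sqr ?nnegrE ?cabs_ge0.
exists (\pi_(Linf R) (MkLpFun (in_LooP (Lp_cmeasurable (repr f)) gM)))%qT.
by rewrite -[LHS]reprK pi_Linf_L2; apply: eq_piLp.
Qed.

End fourier_uniqueness.

(** * Completeness *)

Section L2_completeness.
Context {R : realType}.

Lemma limn_einf_le (v : (\bar R)^nat) (c : \bar R) :
  (forall n, (v n <= c)%E) -> (limn_einf v <= c)%E.
Proof.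
move=> vc; rewrite limn_einf_lim; apply: lime_le; first exact: is_cvg_einfs.
apply: nearW => n; apply: le_trans (vc n); apply: ereal_inf_lbound.
by exists n => /=.
Qed.

Lemma cvg_summable_increments (u d : R^nat) :
  (forall n, `|u n.+1 - u n| <= d n) -> (\sum_(n <oo) (d n)%:E < +oo)%E -> cvgn u.
Proof.
move=> ud dy.
have d0 n : 0 <= d n by exact: le_trans (ud n).
have cd : cvgn (series d).
  apply: nondecreasing_is_cvgn.
    by apply/nondecreasing_seqP => n; rewrite /series/= big_nat_recr//= lerDl.
  exists (fine (\sum_(n <oo) (d n)%:E)%E) => _ [n _ <-].
  rewrite -lee_fin fineK; last first.
    by rewrite ge0_fin_numE//; apply: nneseries_ge0 => *; rewrite lee_fin.
  rewrite /series/= -sumEFin; apply: nneseries_lim_ge => *.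
  by rewrite lee_fin.
have cs : cvgn (series (fun n => u n.+1 - u n)).
  by apply: normed_cvg; apply: (series_le_cvg _ _ _ cd) => n /=.
have -> : u = (fun n => u 0%N + series (fun n => u n.+1 - u n) n).
  apply/funext => n; rewrite /series/= telescope_sumr//.
  by rewrite addrC subrK.
exact: (is_cvgD (is_cvg_cst _) cs).
Qed.

(* The increments are summable in L1 by [2 d <= 2^k d^2 + 2^-k], so a
   representative converges almost everywhere, and Fatou's lemma bounds the
   distance to the limit. *)
Lemma L2_complete (u : nat -> L2 R) :
  (forall j k, (k <= j)%N -> normsq (u j - u k) <= (2^-1 ^+ k) ^+ 2) ->
  exists g, forall k, normsq (g - u k) <= (2^-1 ^+ k) ^+ 2.
Proof.
move=> u_cauchy.
pose f k : circle R -> R[i] := repr (u k).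
have mf k : cmeasurable (f k) by exact: Lp_cmeasurable.
have uE j k : (u j - u k = \pi_(L2 R) (repr (u j) - repr (u k)))%qT.
  by rewrite pi_L2B !reprK.
have sqi j k : circle_prob.-integrable setT
    (EFin \o (fun z => Normc.normc (f j z - f k z) ^+ 2)).
  exact: L2_integrable_sqr (repr (u j) - repr (u k)).
have sqE j k : normsq (u j - u k) =
    \int[circle_prob]_z (Normc.normc (f j z - f k z) ^+ 2).
  by rewrite uE pi_normsq.
pose d k z : R := Normc.normc (f k.+1 z - f k z).
have d0 k z : 0 <= d k z by exact: normc_ge0.
have md k : measurable_fun setT (d k).
  apply: measurable_cabs; apply: cmeasurableD => //.
  under eq_fun do rewrite -mulN1r.
  exact: cmeasurableM (cmeasurable_cst _) (mf k).
have mdE k : measurable_fun setT (fun z => (d k z)%:E).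
  exact/measurable_EFinP.
have int_d k : (\int[circle_prob]_z (d k z)%:E <= (2^-1 ^+ k)%:E)%E.
  pose b z : R := 2^-1 * (2 ^+ k * d k z ^+ 2 + 2^-1 ^+ k).
  have i1 : circle_prob.-integrable setT (EFin \o (fun z => 2 ^+ k * d k z ^+ 2)).
    by have := integrableZl measurableT (2 ^+ k) (sqi k.+1 k).
  have i2 : circle_prob.-integrable setT (EFin \o (fun=> 2^-1 ^+ k : R)).
    exact: finite_measure_integrable_cst.
  have i12 := integrableD measurableT i1 i2.
  have ib : circle_prob.-integrable setT (EFin \o b).
    by have := integrableZl measurableT 2^-1 i12.
  apply: (@le_trans _ _ (\int[circle_prob]_z (b z)%:E)%E).
    apply: ge0_le_integral => //.
    - by move=> z _; rewrite lee_fin.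
    - exact: measurable_int ib.
    - move=> z _; rewrite lee_fin /b.
      have k0 : 0 < 2 ^+ k :> R by rewrite exprn_gt0.
      have := sqr_ge0 (2 ^+ k * d k z - 1); rewrite exprVn.
      move: (2 ^+ k) k0 (d k z) => x x0 y h.
      rewrite -subr_ge0.
      have -> : 2^-1 * (x * y ^+ 2 + x^-1) - y = 2^-1 * (x^-1 * (x * y - 1) ^+ 2).
        by field; rewrite gt_eqF.
      by rewrite mulr_ge0// mulr_ge0// invr_ge0 ltW.
  rewrite -[leLHS]fineK ?integrable_fin_num// lee_fin -[fine _]/(Rintegral _ _ _).
  rewrite RintegralZl// RintegralD// Rintegral_cst// circle_probT mulr1.
  rewrite RintegralZl//; last exact: sqi.
  rewrite -[Rintegral _ _ _](sqE k.+1 k).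
  have := u_cauchy k.+1 k (leqnSn _); rewrite exprVn => h.
  have k0 : 0 < 2 ^+ k :> R by rewrite exprn_gt0.
  have : 2 ^+ k * normsq (u k.+1 - u k) <= (2 ^+ k)^-1.
    rewrite [leRHS](_ : _ = 2 ^+ k * (2 ^+ k)^-1 ^+ 2).
      by rewrite ler_wpM2l// ltW.
    by rewrite expr2 mulrA divff ?mul1r// gt_eqF.
  by move: (_ * normsq _) ((2 ^+ k)^-1) => x y; lra.
pose F z : \bar R := (\sum_(k <oo) (d k z)%:E)%E.
have mF : measurable_fun setT F.
  rewrite /F.
  have := @ge0_emeasurable_sum _ _ _ setT (fun k z => (d k z)%:E) xpredT.
  by apply=> // k z _ _; rewrite lee_fin.
have iF : circle_prob.-integrable setT F.
  apply/integrableP; split=> //.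
  under eq_integral => z _.
    rewrite gee0_abs; last by apply: nneseries_ge0 => k _ _; rewrite lee_fin.
    over.
  rewrite (integral_nneseries circle_prob measurableT mdE); last first.
    by move=> k z _; rewrite lee_fin.
  apply: (@le_lt_trans _ _ (\sum_(k <oo) (2^-1 ^+ k)%:E)%E).
    apply: lee_nneseries => [k _ _|k _]; last exact: int_d.
    by apply: integral_ge0 => z _; rewrite lee_fin.
  have gc : (\sum_(0 <= k < n) (2^-1 ^+ k : R)%:E)%E @[n --> \oo] -->
      (1 * (1 - 2^-1)^-1 : R)%:E.
    under eq_fun do rewrite sumEFin.
    apply: cvg_EFin; first exact: nearW.
    rewrite (_ : _ \o _ = series (geometric 1 (2^-1 : R))).
      by apply: cvg_geometric_series; rewrite ger0_norm// invf_lt1// ltr1n.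
    by apply/funext => n /=; apply: eq_bigr => i _; rewrite /geometric/= mul1r.
  by rewrite (cvg_lim _ gc)// ltry.
have Fy : \forall z \ae circle_prob, (F z < +oo)%E.
  apply: filterS (integrable_ae measurableT iF) => z /(_ Logic.I).
  by rewrite fin_numE ltey => /andP[].
pose E := [set z | (F z < +oo)%E].
have mE : measurable E.
  by rewrite -[E]setTI; exact: emeasurable_fun_infty_o.
(* Cutting off by the indicator of [E] makes the sequences converge at every point, to 0 outside
   [E], so the limit is measurable on the whole circle. *)
pose r k z : R := \1_E z * complex.Re (f k z).
pose s k z : R := \1_E z * complex.Im (f k z).
have cvg_part (p : R[i] -> R) z : (forall x, `|p x| <= Normc.normc x) ->
    {morph p : x y / x - y} -> cvgn (fun k => \1_E z * p (f k z)).
  move=> pn pB; rewrite indicE; case: (boolP (z \in E)) => [|zE].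
    rewrite inE => Ez; under eq_fun do rewrite mul1r.
    by apply: (cvg_summable_increments _ Ez) => k; rewrite -pB.
  by under eq_fun do rewrite mul0r; exact: is_cvg_cst.
have cr z : cvgn (r ^~ z).
  by apply: cvg_part => [x|[? ?] [? ?]//]; exact: Re_le_normc.
have cs z : cvgn (s ^~ z).
  by apply: cvg_part => [x|[? ?] [? ?]//]; exact: Im_le_normc.
pose G z := Complex (limn (r ^~ z)) (limn (s ^~ z)).
have mr k : measurable_fun setT (r k).
  by apply: measurable_funM => //; have [] := mf k.
have ms k : measurable_fun setT (s k).
  by apply: measurable_funM => //; have [] := mf k.
have mG : cmeasurable G.
  by split; [apply: (measurable_fun_cvg mr)|apply: (measurable_fun_cvg ms)].
have mGf k : cmeasurable (fun z => G z - f k z).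
  apply: cmeasurableD => //; under eq_fun do rewrite -mulN1r.
  exact: cmeasurableM (cmeasurable_cst _) (mf k).
have mGf2 k : measurable_fun setT (fun z => Normc.normc (G z - f k z) ^+ 2).
  by apply: measurable_funX; exact: measurable_cabs.
have GfE k : (\int[circle_prob]_z (Normc.normc (G z - f k z) ^+ 2)%:E
    <= ((2^-1 ^+ k) ^+ 2)%:E)%E.
  pose h j z : R := (r j z - complex.Re (f k z)) ^+ 2 + (s j z - complex.Im (f k z)) ^+ 2.
  have mh j : measurable_fun setT (h j).
    have [mf1 mf2] := mf k; apply: measurable_funD; apply: measurable_funX;
      exact: measurable_funB.
  have h0 j z : 0 <= h j z by rewrite addr_ge0// sqr_ge0.
  (* The index is shifted by [k] because the Cauchy hypothesis bounds [u j - u k] only for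
     [k <= j]. *)
  have hG z : (h (k + j)%N z)%:E @[j --> \oo] --> (Normc.normc (G z - f k z) ^+ 2)%:E.
    apply: cvg_EFin; first exact: nearW.
    rewrite sqr_normcE.
    have -> : complex.Re (G z - f k z) = limn (r ^~ z) - complex.Re (f k z).
      by rewrite /G; case: (f k z).
    have -> : complex.Im (G z - f k z) = limn (s ^~ z) - complex.Im (f k z).
      by rewrite /G; case: (f k z).
    have crk : r (k + j)%N z @[j --> \oo] --> limn (r ^~ z).
      exact: (cvg_comp _ _ (cvg_addnl k) (cr z)).
    have csk : s (k + j)%N z @[j --> \oo] --> limn (s ^~ z).
      exact: (cvg_comp _ _ (cvg_addnl k) (cs z)).
    rewrite /h /comp/=.
    under eq_fun do rewrite !expr2; rewrite !expr2.
    apply: cvgD; apply: cvgM; apply: cvgB => //; exact: cvg_cst.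
  under eq_integral => z _ do rewrite -(cvg_limn_einf_sup (hG z)).1.
  apply: le_trans (fatou _ _ _ _) _ => //.
  - by move=> j; exact/measurable_EFinP.
  - by move=> j z _; rewrite lee_fin.
  apply: limn_einf_le => j.
  rewrite (_ : (\int[_]_z _)%E = (normsq (u (k + j)%N - u k))%:E).
    by rewrite lee_fin u_cauchy// leq_addr.
  rewrite sqE fineK; last exact: integrable_fin_num (sqi _ _).
  apply: ae_eq_integral => //.
  - exact/measurable_EFinP.
  - exact: measurable_int (sqi _ _).
  - apply: filterS Fy => z Fz _; congr EFin; rewrite /h /r /s indicE mem_set//.
    by rewrite !mul1r sqr_normcE; case: (f _ z) => a b; case: (f k z).
(* The bound for [k = 0] puts [G - f 0] in [L^2]; adding [u 0] back gives the limit. *)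
have wP : (fun z => G z - f 0%N z) \in Lp_pred_of (R:=R) le1_2.
  apply: in_L2P => //; apply/integrableP; split.
    by apply/measurable_EFinP; exact: (mGf2 0%N).
  under eq_integral => z _ do rewrite gee0_abs ?lee_fin ?sqr_ge0//.
  exact: le_lt_trans (GfE 0%N) (ltry _).
exists (\pi_(L2 R) (MkLpFun wP) + u 0%N)%qT => k.
rewrite (_ : (_ - _)%qT =
    (\pi_(L2 R) (MkLpFun wP + repr (u 0%N) - repr (u k)))%qT); last first.
  by rewrite pi_L2B pi_L2D !reprK.
rewrite pi_normsq -lee_fin.
rewrite (_ : Rintegral _ _ _ = \int[circle_prob]_z (Normc.normc (G z - f k z) ^+ 2)).
  rewrite fineK ?GfE// ge0_fin_numE ?(le_lt_trans (GfE k)) ?ltry//.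
  by apply: integral_ge0 => z _; rewrite lee_fin sqr_ge0.
apply: eq_Rintegral => z _; congr (Normc.normc _ ^+ 2).
by rewrite -[LHS]/(G z - f 0%N z + f 0%N z - f k z) subrK.
Qed.

End L2_completeness.

(** * The projection onto the Hardy space *)

Section hardy_projection.
Context {R : realType}.
Implicit Types (f g h : L2 R) (c : nat -> R[i]).

Lemma fourier_linear (a : R[i]) f g n :
  fourier (a *: f + g) n = a * fourier f n + fourier g n.
Proof. by rewrite !fourierE innerDl innerZl. Qed.

Lemma fourierB f g n : fourier (f - g) n = fourier f n - fourier g n.
Proof. by rewrite !fourierE innerDl innerNl. Qed.

Lemma fourier0 n : fourier (0 : L2 R) n = 0.
Proof. by rewrite fourierE inner0l. Qed.

Definition partial_sum c N : L2 R := \sum_(n < N) c n *: exp_L2 n.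

Definition energy c N : R := \sum_(n < N) Normc.normc (c n) ^+ 2.

Lemma fourier_partial_sum c N (m : int) :
  fourier (partial_sum c N) m =
  if m is Posz n then if (n < N)%N then c n else 0 else 0.
Proof.
rewrite fourierE inner_suml.
under eq_bigr do rewrite innerZl inner_exp_L2.
case: m => n; last by rewrite big1// => i _; rewrite mulr0.
case: ltnP => nN; last first.
  rewrite big1// => i _; rewrite eqz_nat ltn_eqF ?mulr0//.
  exact: leq_trans (ltn_ord i) nN.
rewrite (bigD1 (Ordinal nN))//= eqxx mulr1 big1 ?addr0// => i /negPf iN.
by rewrite eqz_nat -[_ == n]/(i == Ordinal nN) iN mulr0.
Qed.

Lemma inner_partial_sum f c N :
  (forall n, (n < N)%N -> fourier f n = c n) ->
  inner (partial_sum c N) f = (energy c N)%:C%C.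
Proof.
move=> fc; rewrite inner_suml rmorph_sum/=; apply: eq_bigr => n _.
by rewrite innerZl inner_conj -fourierE fc// mulcJ_normc.
Qed.

Lemma normsq_partial_sum c N : normsq (partial_sum c N) = energy c N.
Proof.
apply: complexI; rewrite -inner_normsq inner_partial_sum// => n nN.
by rewrite fourier_partial_sum nN.
Qed.

(** Pythagoras: the partial sum is the orthogonal projection of [f] onto the first [N] exponentials.
    It yields Bessel's inequality and, when [f] is a longer partial sum, the Cauchy estimate. *)
Lemma normsqB_partial_sum f c N : (forall n, (n < N)%N -> fourier f n = c n) ->
  normsq (f - partial_sum c N) = normsq f - energy c N.
Proof.
move=> fc; rewrite normsqD normsqN innerNr inner_conj inner_partial_sum//.
by rewrite normsq_partial_sum /=; ring.
Qed.

Lemma bessel f N : energy (fun n => fourier f n) N <= normsq f.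
Proof. by rewrite -subr_ge0 -normsqB_partial_sum// normsq_ge0. Qed.

Lemma energy_le c M N : (M <= N)%N -> energy c M <= energy c N.
Proof.
move=> /subnKC <-; elim: (N - M)%N => [|k ih]; first by rewrite addn0.
by rewrite addnS (le_trans ih)// /energy big_ord_recr/= lerDl sqr_ge0.
Qed.

Lemma normsqB_partial_sums c M N : (M <= N)%N ->
  normsq (partial_sum c N - partial_sum c M) = energy c N - energy c M.
Proof.
move=> MN; rewrite normsqB_partial_sum ?normsq_partial_sum// => n nM.
by rewrite fourier_partial_sum (leq_trans nM).
Qed.

Lemma exists_small_power (e : R) : 0 < e -> exists k0, forall k, (k0 <= k)%N ->
  (2^-1 ^+ k) ^+ 2 <= e.
Proof.
move=> e0.
have h1 : `|2^-1 : R| < 1 by rewrite ger0_norm// invf_lt1// ltr1n.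
have := cvg_geometric 1 h1 => /cvgrPdist_le /(_ _ e0)[k0 _ hk].
exists k0 => k kk0; have := hk k kk0; rewrite /geometric/= sub0r normrN mul1r.
have k2 : 0 <= (2^-1 : R) ^+ k <= 1.
  by rewrite exprn_ge0//= exprn_ile1// invf_le1// ler1n.
move: (2^-1 ^+ k) k2 => x /andP[x0 x1]; rewrite ger0_norm// => xe.
by rewrite (le_trans _ xe)// expr2 ler_piMl.
Qed.

(** The energies increase and are bounded, so a subsequence of partial sums is Cauchy at the rate
    that [L2_complete] asks for. The approximation clause is kept for the density of polynomials. *)
Lemma riesz_fischer c B : (forall N, energy c N <= B) ->
  exists g, (forall m, fourier g m = if m is Posz n then c n else 0) /\
    (forall e, 0 < e -> exists N, normsq (g - partial_sum c N) <= e).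
Proof.
move=> cB.
have ub : has_ubound (range (energy c)) by exists B => _ [N _ <-].
have /choice[N hN] : forall k, exists n, forall M, (n <= M)%N ->
    energy c M - energy c n <= (2^-1 ^+ k) ^+ 2.
  move=> k.
  have k0 : 0 < (2^-1 ^+ k) ^+ 2 :> R by rewrite !exprn_gt0// invr_gt0.
  have [_ [n _ <-] hn] := sup_adherent k0
    (conj (ex_intro _ _ (imageT (energy c) 0%N)) ub).
  exists n => M nM; rewrite lerBlDl.
  have : energy c M <= sup (range (energy c)) by apply: sup_ubound => //; exists M.
  by move: hn; lra.
(* Summing successors makes [N'] monotone, at least [N k], and larger than [k]. The last property
   ensures that every given coefficient is eventually included. *)
pose N' k := (\sum_(i < k.+1) (N i).+1)%N.
have N'mono j k : (k <= j)%N -> (N' k <= N' j)%N.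
  move=> /subnKC <-; elim: (j - k)%N => [|i ih]; first by rewrite addn0.
  by rewrite addnS (leq_trans ih)// /N' [X in (_ <= X)%N]big_ord_recr leq_addr.
have N'k k : (k < N' k)%N.
  elim: k => [|k ih]; first by rewrite /N' big_ord_recr big_ord0.
  by rewrite /N' big_ord_recr/= -addn1 leq_add.
have NN' k : (N k <= N' k)%N.
  by rewrite /N' big_ord_recr/= (leq_trans (leqnSn _))// leq_addl.
have [|g hg] := @L2_complete _ (fun k => partial_sum c (N' k)).
  move=> j k kj; rewrite normsqB_partial_sums ?N'mono//.
  apply: le_trans (hN k (N' j) (leq_trans (NN' k) (N'mono _ _ kj))).
  by rewrite lerD2l lerN2 energy_le.
exists g; split => [m|e /exists_small_power[k0 /(_ k0 (leqnn _)) hk]]; last first.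
  by exists (N' k0); exact: le_trans (hg k0) hk.
apply/eqP; rewrite -subr_eq0; apply/eqP.
apply: (@inner_eq0_approx _ _ (exp_L2 m)) => e /exists_small_power[k0 hk].
pose k := maxn k0 `|m|%N.
exists (g - partial_sum c (N' k)).
  by apply: le_trans (hg k) (hk _ _); exact: leq_maxl.
rewrite -fourierE fourierB fourier_partial_sum; congr (_ - _).
case: m @k => [n|//] k; rewrite ifT//.
by apply: leq_ltn_trans (N'k _); exact: leq_maxr.
Qed.

End hardy_projection.

(** * The orthogonal complement and the flip *)

Section hardy_complement.
Context {R : realType}.
Implicit Types (f g h : L2 R) (a b : Linf R).

(** The orthogonal complement of [hardy] read on coefficients; [ortho_hardyP] identifies the two. *)
Definition antihardy : set (L2 R) := [set f | forall n : nat, fourier f n = 0].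

Lemma hardy_linear (c : R[i]) f g : hardy f -> hardy g -> hardy (c *: f + g).
Proof. by move=> hf hg n n0; rewrite fourier_linear hf// hg// mulr0 addr0. Qed.

Lemma hardyB f g : hardy f -> hardy g -> hardy (f - g).
Proof. by move=> hf hg n n0; rewrite fourierB hf// hg// subr0. Qed.

Lemma antihardyB f g : antihardy f -> antihardy g -> antihardy (f - g).
Proof. by move=> hf hg n; rewrite fourierB hf hg subr0. Qed.

Lemma hardy0 : hardy (0 : L2 R).
Proof. by move=> n _; rewrite fourier0. Qed.

Lemma antihardy0 : antihardy 0.
Proof. by move=> n; rewrite fourier0. Qed.

Lemma hardy_antihardy_eq0 f : hardy f -> antihardy f -> f = 0.
Proof. by move=> hf af; apply: fourier_inj => -[n|n]; [exact: af|exact: hf]. Qed.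

Lemma hardy_exp_L2 (n : nat) : hardy (exp_L2 n : L2 R).
Proof. by case=> // m _; rewrite fourierE inner_exp_L2. Qed.

(** [riesz_fischer] rebuilds a function from the nonnegative coefficients of [f] as a limit of
    partial sums; uniqueness of coefficients identifies it with [f]. *)
Lemma hardy_approx f : hardy f -> forall e, 0 < e ->
  exists N, normsq (f - partial_sum (fun n => fourier f n) N) <= e.
Proof.
move=> hf; have [g [gf ge]] := riesz_fischer (bessel f).
have <- : g = f.
  apply/eqP; rewrite -subr_eq0; apply/eqP/fourier_inj => n.
  by rewrite fourierB gf; case: n => n; rewrite ?subrr// hf// subrr.
have gE : (fun n : nat => fourier g n) = (fun n => fourier f n).
  by apply/funext => n; rewrite gf.
by move=> e /ge[N gN]; exists N; rewrite gE.
Qed.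

(** For the converse, partial sums of [g] are orthogonal to [h] by their coefficients, so [<g, h>]
    is also the product of [h] with an arbitrarily small remainder. *)
Lemma ortho_hardyP h : Defs.ortho (@hardy R) h <-> antihardy h.
Proof.
split=> [hh n|hh g hg]; first by rewrite fourierE; apply: hh; exact: hardy_exp_L2.
rewrite inner_conj (_ : inner g h = 0) ?conjc0//.
apply: (@inner_eq0_approx _ _ h) => e /(hardy_approx hg)[N gN].
eexists; first exact: gN.
rewrite innerDl innerNl inner_suml big1 ?subr0// => n _.
by rewrite innerZl inner_conj -fourierE hh conjc0 mulr0.
Qed.

(** Bessel bounds the energies of [f], so [riesz_fischer] supplies an element of [H^2] with its
    nonnegative coefficients. Hence the [xget] in [orthoproj] picks a genuine projection. *)
Lemma proj_hardyP f : hardy (proj_hardy f) /\ antihardy (proj_hardyC f).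
Proof.
have [g [gf _]] := riesz_fischer (bessel f).
suff : [set g | hardy g /\ Defs.ortho (@hardy R) (f - g)] (proj_hardy f).
  by case=> ? /ortho_hardyP.
apply: (@xgetPex _ 0); exists g; split; first by case=> // n _; rewrite gf.
by apply/ortho_hardyP => n; rewrite fourierB gf subrr.
Qed.

Lemma proj_hardy_eq f g : hardy g -> antihardy (f - g) -> proj_hardy f = g.
Proof.
move=> hg afg; have [hp ap] := proj_hardyP f.
apply/eqP; rewrite -subr_eq0; apply/eqP/hardy_antihardy_eq0; first exact: hardyB.
have -> : proj_hardy f - g = (f - g) - (f - proj_hardy f).
  by rewrite opprB [RHS]addrC addrA subrK.
exact: antihardyB.
Qed.

Lemma proj_hardy_id f : hardy f -> proj_hardy f = f.
Proof. by move=> hf; apply: proj_hardy_eq => //; rewrite subrr; exact: antihardy0. Qed.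

Lemma proj_hardy_antihardy f : antihardy f -> proj_hardy f = 0.
Proof. by move=> af; apply: proj_hardy_eq; rewrite ?subr0//; exact: hardy0. Qed.

Lemma inner_hardy_antihardy f g : hardy f -> antihardy g -> inner f g = 0.
Proof. by move=> hf /ortho_hardyP/(_ _ hf) gf; rewrite inner_conj gf conjc0. Qed.

Lemma inner_antihardy_hardy f g : antihardy f -> hardy g -> inner f g = 0.
Proof. by move=> /ortho_hardyP fo /fo. Qed.

(** For [n < 0] the coefficient is the inner product of [f] with [conj a * z^n]. The latter is in
    [antihardy]: its coefficient at [m >= 0] is the conjugate of that of [a] at [n - m < 0]. *)
Lemma hardy_mul a f : hardy (Linf_L2 a) -> hardy f -> hardy (Linf_mul a f).
Proof.
move=> ha hf n n0; rewrite fourierE inner_Linf_mul; apply: inner_hardy_antihardy => // m.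
rewrite fourierE inner_Linf_mul Lp_conjK Linf_mul_exp_L2 inner_conj.
rewrite -fourierE fourier_exp_Linf_mul ha ?conjc0//.
by rewrite subr_lt0 (lt_le_trans n0).
Qed.

Lemma antihardy_mul b f :
  hardy (Linf_L2 (Lp_conj b)) -> antihardy f -> antihardy (Linf_mul b f).
Proof.
move=> hb af n; rewrite fourierE inner_Linf_mul.
by apply: inner_antihardy_hardy => //; apply: hardy_mul => //; exact: hardy_exp_L2.
Qed.

Lemma hardy_z f : hardy f -> hardy (Linf_mul (exp_Linf 1) f).
Proof.
move=> hf n n0; rewrite fourier_exp_Linf_mul hf// subr_lt0.
exact: lt_le_trans n0 _.
Qed.

Lemma antihardy_zbar f : antihardy f -> antihardy (Linf_mul (exp_Linf (-1)) f).
Proof. by move=> af n; rewrite fourier_exp_Linf_mul opprK -PoszD. Qed.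

Lemma exp_Linf_mulK m f : Linf_mul (exp_Linf (- m)) (Linf_mul (exp_Linf m) f) = f.
Proof. by rewrite exp_Linf_mul addNr exp_Linf0_mul. Qed.

Lemma Lp_conj_Linf_L2 a : Lp_conj (Linf_L2 a) = Linf_L2 (Lp_conj a).
Proof.
by rewrite -[a]reprK pi_Linf_L2 !pi_Lp_conj pi_Linf_L2; apply: eq_piLp.
Qed.

Lemma Lp_conj_linear (c : R[i]) f g :
  Lp_conj (c *: f + g) = conjc c *: Lp_conj f + Lp_conj g.
Proof.
rewrite -[f]reprK -[g]reprK -pi_L2Z -pi_L2D !pi_Lp_conj -pi_L2Z -pi_L2D.
by apply: eq_piLp => z; rewrite -[LHS]/(conjc (c * _ + _)) conjcD conjcM.
Qed.

Lemma Lp_conj_mul a f : Lp_conj (Linf_mul a f) = Linf_mul (Lp_conj a) (Lp_conj f).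
Proof.
rewrite -[a]reprK -[f]reprK (pi_Linf_mul (repr a)) !pi_Lp_conj pi_Linf_mul.
by apply: eq_piLp => z; rewrite /= conjcM.
Qed.

Lemma inner_Lp_conj f g : inner (Lp_conj f) (Lp_conj g) = conjc (inner f g).
Proof.
rewrite -[f]reprK -[g]reprK !pi_Lp_conj !pi_inner.
rewrite -cintegral_conj; last exact: cintegrable_inner.
by congr cintegral; apply/funext => z; rewrite /= conjcM.
Qed.

Lemma normsq_Lp_conj f : normsq (Lp_conj f) = normsq f.
Proof.
by apply: complexI; rewrite -!inner_normsq inner_Lp_conj inner_normsq conjc_real.
Qed.

Lemma normsq_exp_Linf n f : normsq (Linf_mul (exp_Linf n) f) = normsq f.
Proof.
by apply: complexI; rewrite -!inner_normsq inner_Linf_mul conj_exp_Linf exp_Linf_mulK.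
Qed.

(* The antiunitary involution [f |-> conj (z f)] exchanges [H^2] and its
   orthogonal complement, and turns multiplication by [z] into multiplication
   by [conj z]. *)
Definition flip f : L2 R := Linf_mul (exp_Linf (-1)) (Lp_conj f).

Lemma flip_linear (c : R[i]) f g : flip (c *: f + g) = conjc c *: flip f + flip g.
Proof. by rewrite /flip Lp_conj_linear Linf_mul_linear. Qed.

Lemma flip_mul a f : flip (Linf_mul a f) = Linf_mul (Lp_conj a) (flip f).
Proof. by rewrite /flip Lp_conj_mul Linf_mulCA. Qed.

Lemma flipK : involutive flip.
Proof.
move=> f; rewrite /flip Lp_conj_mul conj_exp_Linf Lp_conjK; exact: exp_Linf_mulK.
Qed.

Lemma normsq_flip f : normsq (flip f) = normsq f.
Proof. by rewrite normsq_exp_Linf normsq_Lp_conj. Qed.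

(** The extra shift by one makes the reversal of indices exchange [n >= 0] with [n < 0]; conjugation
    alone would fix index 0. *)
Lemma fourier_flip f n : fourier (flip f) n = conjc (fourier f (- (n + 1))).
Proof.
rewrite fourier_exp_Linf_mul opprK !fourierE -inner_Lp_conj; congr inner.
by rewrite /exp_L2 Lp_conj_Linf_L2 conj_exp_Linf opprK.
Qed.

Lemma flip_hardy f : hardy f -> antihardy (flip f).
Proof.
by move=> hf n; rewrite fourier_flip hf ?conjc0// oppr_lt0.
Qed.

Lemma flip_antihardy f : antihardy f -> hardy (flip f).
Proof.
move=> af [//|n] _; rewrite fourier_flip NegzE -addn1 PoszD opprD opprK addrK.
by rewrite af conjc0.
Qed.

End hardy_complement.

(** * The commutant *)

Section hardy_commutant.
Context {R : realType}.
Implicit Types (T : L2 R -> L2 R) (f : L2 R).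

Lemma bounded_operator_normsq T : bounded_operator T ->
  linear T /\ exists M : R, forall f, normsq (T f) <= M ^+ 2 * normsq f.
Proof.
move=> [lT [M TM]]; split=> //; exists M => f.
rewrite -!L2norm_sqr -exprMn ler_sqr ?nnegrE ?L2norm_ge0//.
exact: le_trans (L2norm_ge0 _) (TM f).
Qed.

Lemma linear_partial_sum T (lT : linear T) c N :
  T (partial_sum c N) = \sum_(n < N) c n *: T (exp_L2 n).
Proof.
elim: N => [|N ih]; first by rewrite /partial_sum !big_ord0 linear_fun0.
by rewrite /partial_sum !big_ord_recr/= addrC lT ih addrC.
Qed.

(** The symbol is [T 1]: it is a bounded multiplier because [T p = p * T 1] on polynomials. Density
    of polynomials then extends the formula to [H^2], one Fourier coefficient at a time. *)
Lemma hardy_commutant T (M : R) : linear T ->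
  (forall f, normsq (T f) <= M ^+ 2 * normsq f) ->
  (forall f, hardy f -> hardy (T f)) ->
  (forall f, hardy f -> T (Linf_mul (exp_Linf 1) f) = Linf_mul (exp_Linf 1) (T f)) ->
  exists a, hardy (Linf_L2 a) /\ forall f, hardy f -> T f = Linf_mul a f.
Proof.
move=> lT TM Th Tz.
pose e0 : L2 R := exp_L2 0; have he0 : hardy e0 by exact: (hardy_exp_L2 0%N).
have Tpoly p : hardy (Linf_mul (poly_Linf p) e0) /\
    T (Linf_mul (poly_Linf p) e0) = Linf_mul (poly_Linf p) (T e0).
  elim/poly_ind: p => [|p c [hp Tp]].
    by rewrite !poly_Linf0_mul (linear_fun0 lT); split => //; exact: hardy0.
  rewrite !poly_Linf_mulMXaddC; split; first by apply: hardy_linear => //; exact: hardy_z.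
  by rewrite lT Tz// Tp.
have [a Ta] : exists a, T e0 = Linf_L2 a.
  apply: (@multiplier_bounded _ _ M) => p.
  by rewrite -(Tpoly p).2 poly_L2E.
exists a; split; first by rewrite -Ta; exact: Th.
have Texp (n : nat) : T (exp_L2 n) = Linf_mul a (exp_L2 n).
  elim: n => [|n ih]; first by rewrite Linf_mul_exp_L2 exp_Linf0_mul -Ta.
  have -> : exp_L2 n.+1 = Linf_mul (exp_Linf 1) (exp_L2 n) :> L2 R.
    by rewrite exp_Linf_L2 -PoszD add1n.
  rewrite (Tz _ (hardy_exp_L2 n)) ih; exact: Linf_mulCA.
move=> f hf; apply/eqP; rewrite -subr_eq0; apply/eqP/fourier_inj => m.
rewrite fourierE.
(* With [r] the remainder of [f] after a partial sum, [T f - a f = T r - a r]. Moving [a] to the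
   other side by its adjoint leaves only [T r] and [r], both known to be small. *)
apply: (@inner_eq0_approx2 _ _ (exp_L2 m) (- Linf_mul (Lp_conj a) (exp_L2 m))) => e e0'.
(* This threshold makes both [|r|^2] and [M^2 |r|^2] at most [e], whatever [M] is. *)
have eM : 0 < e / (1 + M ^+ 2) by rewrite divr_gt0// ltr_pwDl// sqr_ge0.
have [N fN] := hardy_approx hf eM.
set r := f - _ in fN.
have rM : M ^+ 2 * normsq r <= e /\ normsq r <= e.
  have M1 : 0 < 1 + M ^+ 2 by rewrite ltr_pwDl// sqr_ge0.
  move: fN; rewrite ler_pdivlMr// mulrDr mulr1 => h.
  have M0 := sqr_ge0 M; have r0 := normsq_ge0 r.
  by split; have := mulr_ge0 r0 M0; lra.
exists (T r), r; split; [exact: le_trans (TM r) rM.1|exact: rM.2|].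
rewrite innerNr -inner_Linf_mul -innerNl -innerDl; congr inner.
have rE : r = (-1) *: partial_sum (fun n => fourier f n) N + f.
  by rewrite scaleN1r addrC.
rewrite rE lT Linf_mul_linear !linear_partial_sum//; last exact: Linf_mul_linear.
under eq_bigr do rewrite Texp.
by rewrite opprD addrACA subrr add0r.
Qed.

End hardy_commutant.

Theorem theorem4p5 (R : realType) (T : L2 R -> L2 R) :
  bounded_operator T ->
  (((T \o S_op (z_Linf : Linf R) 0 =1 S_op (z_Linf : Linf R) 0 \o T) /\
   (T \o S_op 0 (zbar_Linf : Linf R) =1 S_op 0 (zbar_Linf : Linf R) \o T))
  <->
  (exists alpha beta : Linf R,
     [/\ analytic (Linf_L2 alpha), coanalytic (Linf_L2 beta)
       & T = S_op alpha beta])).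
Proof.
move=> /bounded_operator_normsq[lT [M TM]].
have SzE f : S_op (z_Linf : Linf R) 0 f = Linf_mul (exp_Linf 1) (proj_hardy f).
  by rewrite /S_op Linf_mul0 addr0 z_LinfE.
have SzbarE f :
    S_op 0 (zbar_Linf : Linf R) f = Linf_mul (exp_Linf (-1)) (proj_hardyC f).
  by rewrite /S_op Linf_mul0 add0r zbar_LinfE.
have T0 := linear_fun0 lT.
split=> [[Tz Tzbar]|[a [b [ha hb TE]]]].
- have {}Tz f : T (Linf_mul (exp_Linf 1) (proj_hardy f)) =
      Linf_mul (exp_Linf 1) (proj_hardy (T f)).
    by rewrite -!SzE; exact: Tz.
  have {}Tzbar f : T (Linf_mul (exp_Linf (-1)) (proj_hardyC f)) =
      Linf_mul (exp_Linf (-1)) (proj_hardyC (T f)).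
    by rewrite -!SzbarE; exact: Tzbar.
  (* On [H^2] the operator [S_op 0 zbar_Linf] vanishes, so commutation gives [conj z * Q (T f) = 0];
     multiplication by [conj z] is injective. The next step is symmetric. *)
  have Thardy f : hardy f -> hardy (T f).
    move=> hf; have := Tzbar f; rewrite /proj_hardyC (proj_hardy_id hf) subrr.
    rewrite Linf_mulr0 T0 => /(congr1 (Linf_mul (exp_Linf (- -1)))).
    rewrite exp_Linf_mulK Linf_mulr0 => /esym/eqP; rewrite subr_eq0 => /eqP ->.
    by have [] := proj_hardyP (T f).
  have Tanti f : antihardy f -> antihardy (T f).
    move=> af; have := Tz f; rewrite (proj_hardy_antihardy af).
    rewrite Linf_mulr0 T0 => /(congr1 (Linf_mul (exp_Linf (- 1)))).
    rewrite exp_Linf_mulK Linf_mulr0 => P0.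
    by have [_] := proj_hardyP (T f); rewrite /proj_hardyC -P0 subr0.
  have [a [ha Ta]] : exists a, hardy (Linf_L2 a) /\
      forall f, hardy f -> T f = Linf_mul a f.
    apply: (@hardy_commutant _ T M) => // f hf.
    by have := Tz f; rewrite !proj_hardy_id//; exact: Thardy.
  (* Conjugating [T] by the flip brings its action on the complement to [H^2]; the two antilinear
     factors make the composite linear again. *)
  have [b [hb Tb]] : exists b, hardy (Linf_L2 b) /\
      forall f, hardy f -> flip (T (flip f)) = Linf_mul b f.
    apply: (@hardy_commutant _ (flip \o T \o flip) M) => [c f g|f|f hf|f hf] /=.
    - by rewrite flip_linear lT flip_linear conjcK.
    - by rewrite normsq_flip -(normsq_flip f).
    - by apply/flip_antihardy/Tanti/flip_hardy.
    - rewrite flip_mul conj_exp_Linf.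
      have := Tzbar (flip f); rewrite /proj_hardyC !proj_hardy_antihardy.
      + by rewrite !subr0 => ->; rewrite flip_mul conj_exp_Linf opprK.
      + exact/Tanti/flip_hardy.
      + exact: flip_hardy.
  (* Undoing the flip conjugates the symbol, so an analytic [b] becomes a co-analytic one. *)
  exists a, (Lp_conj b); split => //.
    by rewrite /coanalytic Lp_conj_Linf_L2 Lp_conjK.
  apply/funext => f; have [hp ap] := proj_hardyP f.
  have -> : T f = T (proj_hardy f) + T (proj_hardyC f).
    have := lT 1 (proj_hardy f) (proj_hardyC f); rewrite !scale1r => <-.
    by rewrite /proj_hardyC addrC subrK.
  rewrite /S_op Ta//; congr (_ + _).
  rewrite -[LHS]flipK -[X in T X]flipK Tb; last exact: flip_antihardy.
  by rewrite flip_mul flipK.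
- have hb' : hardy (Linf_L2 (Lp_conj b)) by rewrite -Lp_conj_Linf_L2.
  (* Analyticity of [a] and co-analyticity of [b] keep the two summands of [T f] in their own
     subspaces, so [P T = a P] and [Q T = b Q]. Commutation is then that of multiplications. *)
  have PT f : proj_hardy (T f) = Linf_mul a (proj_hardy f).
    have [hp ap] := proj_hardyP f.
    apply: proj_hardy_eq; first exact: hardy_mul.
    by rewrite TE /S_op addrC addKr; exact: antihardy_mul.
  have QT f : proj_hardyC (T f) = Linf_mul b (proj_hardyC f).
    by rewrite {1}/proj_hardyC PT TE /S_op addrC addKr.
  split=> f /=.
  + rewrite !SzE PT TE /S_op.
    have hzP : hardy (Linf_mul (exp_Linf 1) (proj_hardy f)).
      by apply: hardy_z; have [] := proj_hardyP f.
    by rewrite /proj_hardyC (proj_hardy_id hzP) subrr Linf_mulr0 addr0 Linf_mulCA.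
  + rewrite !SzbarE QT TE /S_op.
    have azQ : antihardy (Linf_mul (exp_Linf (-1)) (proj_hardyC f)).
      by apply: antihardy_zbar; have [] := proj_hardyP f.
    by rewrite (proj_hardy_antihardy azQ) /proj_hardyC (proj_hardy_antihardy azQ) subr0
      Linf_mulr0 add0r Linf_mulCA.
Qed.
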